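(* Let $d\in\mathbb{N}$, let $\alpha\in(d-1,\infty)$ be known, and let $\mathfrak{W}^{(1)},\mathfrak{W}^{(2)},\dots$ be i.i.d. with law $\mathcal{W}_d(\alpha,\Sigma)$. Suppose that the true scale matrix $\Sigma\in\mathcal{S}_{++}^d$ admits the linear representation $$\Sigma=\Sigma(\boldsymbol\beta^\star)=\sum_{j=1}^p\beta_j^\star B_j$$ for some $\boldsymbol\beta^\star\in\mathbb{R}^p$ and fixed symmetric templates $\{B_j\}_{j=1}^p\subseteq\mathcal{S}^d$, where $\Sigma(\boldsymbol\beta)=\sum_{j=1}^p\beta_jB_j$. Let $\{U_m\}_{m=1}^M\subseteq\mathcal{S}^d$ be given, and for the corresponding linear probes $f_{U_m}(S)=\mathrm{tr}(U_mS)$, form the structured Stein moment equations $$\mathrm{tr}\{\Sigma(\boldsymbol\beta)U_m\}=y_{n,m},\qquad y_{n,m}=\frac1{\alpha n}\sum_{k=1}^n\mathrm{tr}(\mathfrak{W}^{(k)}U_m),\qquad m\in\{1,\dots,M\}.$$ Let $C\in\mathbb{R}^{M\times p}$ be the design matrix with entries $C_{mj}=\mathrm{tr}(B_jU_m)$, and let $\boldsymbol y_n=(y_{n,1},\dots,y_{n,M})^\top$. If $C$ has full column rank, then the least-squares solution $$\widehat{\boldsymbol\beta}_n=\arg\min_{\boldsymbol\beta\in\mathbb{R}^p}\|C\boldsymbol\beta-\boldsymbol y_n\|_2^2=(C^\top C)^{-1}C^\top\boldsymbol y_n$$ is strongly consistent for the true coefficient vector $\boldsymbol\beta^\star$ as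 $n\to\infty$ (that is, $\widehat{\boldsymbol\beta}_n\to\boldsymbol\beta^\star$ almost surely). In particular, the structured estimator $\widehat\Sigma_n=\Sigma(\widehat{\boldsymbol\beta}_n)=\sum_{j=1}^p\hat\beta_{n,j}B_j$ converges almost surely to $\Sigma$ and solves the structured Stein moment equations in the least-squares sense.
   Context: $\mathcal{S}^d,\mathcal{S}_{++}^d$: real symmetric, positive definite $d\times d$ matrices. For $\alpha>d-1$, $\mathcal{W}_d(\alpha,\Sigma)$ is the Wishart law on $\mathcal{S}_{++}^d$ with density $|X|^{\alpha/2-(d+1)/2}e^{-\mathrm{tr}(\Sigma^{-1}X)/2}/\{|2\Sigma|^{\alpha/2}\Gamma_d(\alpha/2)\}$, $|\cdot|$ the determinant, $\Gamma_d(\nu)=\int_{\mathcal{S}_{++}^d}e^{-\mathrm{tr}X}|X|^{\nu-(d+1)/2}\mathrm{d}X$. *)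

(* Defs.v *)
From HB Require Import structures.
From mathcomp Require Import all_boot all_order all_algebra finmap.
From mathcomp Require Import all_classical all_reals all_analysis.

Set Implicit Arguments.
Unset Strict Implicit.
Unset Printing Implicit Defensive.

Import Order.TTheory GRing.Theory Num.Theory.
Import numFieldNormedType.Exports.

Local Open Scope classical_set_scope.
Local Open Scope ring_scope.

Definition measure_matrix_display : measure_display -> measure_display.
Proof. exact. Qed.

Section measurable_matrix.
Context {d} {T : measurableType d} (m n : nat).

(* The sigma-algebra generated by the entries; for T := R it is the Borel
   sigma-algebra of 'M[R]_(m, n). *)
Definition measurable_matrix : set (set 'M[T]_(m, n)) :=
  <<s [set A | exists i j (B : set T),
         measurable B /\ A = (fun X : 'M[T]_(m, n) => X i j) @^-1` B] >>.

Let matrix_set0 : measurable_matrix set0.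
Proof. exact: sigma_algebra0. Qed.

Let matrix_setC A : measurable_matrix A -> measurable_matrix (~` A).
Proof. exact: sigma_algebraC. Qed.

Let matrix_bigcup (F : (set 'M[T]_(m, n))^nat) :
  (forall i, measurable_matrix (F i)) -> measurable_matrix (\bigcup_i F i).
Proof. exact: sigma_algebra_bigcup. Qed.

HB.instance Definition _ := @isMeasurable.Build (measure_matrix_display d)
  'M[T]_(m, n) measurable_matrix matrix_set0 matrix_setC matrix_bigcup.

End measurable_matrix.

Lemma measurable_fun_matrixP d d' (T : measurableType d)
    (T' : measurableType d') m n (f : T' -> 'M[T]_(m, n)) :
  measurable_fun setT f <->
  forall i j, measurable_fun setT (fun x => f x i j).
Proof.
split=> [mf i j|mf].
  move=> _ B mB; rewrite setTI.
  rewrite -[X in measurable X](setTI (f @^-1` ((fun X => X i j) @^-1` B))).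
  by apply: mf => //; apply: sub_sigma_algebra; exists i, j, B.
apply: (@measurability _ _ _ _ _ _
  [set A | exists i j (B : set T),
     measurable B /\ A = (fun X : 'M[T]_(m, n) => X i j) @^-1` B]) => //.
by move=> _ [_ [i [j [B [mB ->]]]] <-]; exact: mf.
Qed.

Fixpoint lebesgue_tuple (R : realType) (n : nat) : set (n.-tuple R) -> \bar R :=
  if n is n'.+1 then
    pushforward (lebesgue_measure \x @lebesgue_tuple R n')%E
      (fun xt : measurableTypeR R * n'.-tuple R =>
         [tuple of xt.1 :: xt.2] : n'.+1.-tuple R)
  else \d_[tuple].

Section lebesgue_tuple_measure.
Context (R : realType).
Local Notation cons_tup n :=
  (fun xt : measurableTypeR R * n.-tuple R => [tuple of xt.1 :: xt.2] : n.+1.-tuple R).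

Lemma measurable_cons_tuple n : measurable_fun setT (cons_tup n).
Proof. exact: (measurable_cons measurable_fst measurable_snd). Qed.

Lemma measurable_uncons_tuple n : measurable_fun setT
  (fun t : n.+1.-tuple R =>
     (thead t, [tuple of behead t]) : measurableTypeR R * n.-tuple R).
Proof.
apply/measurable_fun_pairP; split; last exact: measurable_behead.
exact: measurable_tnth.
Qed.


Let lebesgue_tuple_spec n :
  [/\ @lebesgue_tuple R n set0 = 0%E,
      forall A, (0 <= @lebesgue_tuple R n A)%E,
      semi_sigma_additive (@lebesgue_tuple R n) &
      sigma_finite setT (@lebesgue_tuple R n)].
Proof.
elim: n => [|n].
  pose D : {measure set (0.-tuple R) -> \bar R} := \d_[tuple].
  split=> /=; [exact: (measure0 D)|by move=> A; exact: (measure_ge0 D)| |].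
    exact: (@measure_semi_sigma_additive _ _ _ D).
  apply: fin_num_fun_sigma_finite => [|A mA]; first by rewrite (measure0 D) ltry.
  by rewrite diracE.
rewrite [@lebesgue_tuple R n.+1]/=.
move: (@lebesgue_tuple R n) => f [f0 f_ge0 f_sadd f_sf].
pose HM := isMeasure.Build _ _ _ f f0 f_ge0 f_sadd.
pose fM : {measure set (n.-tuple R) -> \bar R} := HB.pack f HM.
pose HS := @Measure_isSigmaFinite.Build _ _ _ fM f_sf.
pose nu : {sigma_finite_measure set (n.-tuple R) -> \bar R} := HB.pack f HM HS.
pose pm : {measure set (measurableTypeR R * n.-tuple R) -> \bar R} :=
  (@lebesgue_measure R \x nu)%E.
split.
- by rewrite /pushforward preimage_set0; exact: (measure0 pm).
- by move=> A; exact: (measure_ge0 pm).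
- exact: (@measure_semi_sigma_additive _ _ _
    (measure_function_pushforward__canonical__measure_function_Measure
       pm (@measurable_cons_tuple n))).
have /sigma_finiteP[F [FT ndF mF]] := sigma_finiteT (@lebesgue_measure R).
have /sigma_finiteP[G [GT ndG mG]] := sigma_finiteT nu.
exists (fun k => (fun t : n.+1.-tuple R =>
    (thead t, [tuple of behead t]) : measurableTypeR R * n.-tuple R)
      @^-1` (F k `*` G k)).
  apply/esym/seteqP; split=> // t _ /=.
  have : [set: measurableTypeR R] (thead t) by [].
  have : [set: n.-tuple R] [tuple of behead t] by [].
  rewrite FT GT => -[k _ Gk] [l _ Fl]; exists (maxn l k) => //; split => /=.
    by move: Fl; exact/subsetPset/ndF/leq_maxl.
  by move: Gk; exact/subsetPset/ndG/leq_maxr.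
move=> k; have [mFk Fk] := mF k; have [mGk Gk] := mG k; split.
  rewrite -[X in measurable X]setTI; apply: measurable_uncons_tuple => //.
  exact: measurableX.
rewrite /pushforward (_ : _ @^-1` _ = F k `*` G k); last first.
  have bE (x : R) (t : n.-tuple R) : [tuple of behead [tuple of x :: t]] = t.
    exact/val_inj.
  by apply/seteqP; split=> -[x t] /=; rewrite theadE bE.
have := product_measure1E (@lebesgue_measure R) nu mFk mGk.
by move=> /= ->; rewrite lte_mul_pinfty// ge0_fin_numE.
Qed.

Variable n : nat.
Local Notation leb := (@lebesgue_tuple R n).

Let leb0 : leb set0 = 0%E.
Proof. by have [] := lebesgue_tuple_spec n. Qed.

Let leb_ge0 A : (0 <= leb A)%E.
Proof. by have [] := lebesgue_tuple_spec n. Qed.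

Let leb_sigma_additive : semi_sigma_additive leb.
Proof.
by have [] := lebesgue_tuple_spec n.
Qed.

HB.instance Definition _ := isMeasure.Build _ _ _ leb
  leb0 leb_ge0 leb_sigma_additive.

Let leb_sigma_finite : sigma_finite setT leb.
Proof. by have [] := lebesgue_tuple_spec n. Qed.

HB.instance Definition _ := @Measure_isSigmaFinite.Build _ _ _ leb
  leb_sigma_finite.

End lebesgue_tuple_measure.

Lemma lebesgue_tuple_box (R : realType) n (A : 'I_n -> set R) :
  (forall i, measurable (A i)) ->
  lebesgue_tuple [set t : n.-tuple R | forall i, A i (tnth t i)] =
  (\prod_(i < n) lebesgue_measure (A i))%E.
Proof.
elim: n A => [|n IH] A mA.
  rewrite big_ord0 /= diracE mem_set//= => -[]//.
rewrite big_ord_recl -IH//= /pushforward.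
rewrite -product_measure1E//; last first.
  rewrite (_ : [set t | _] = \bigcap_(i in [set: 'I_n])
    (@tnth n R ^~ i) @^-1` A (lift ord0 i)); last first.
    by apply/seteqP; split=> [t h i _|t h i]; [exact: h|exact: (h i)].
  apply: fin_bigcap_measurable => // i _.
  by rewrite -[X in measurable X]setTI; exact: measurable_tnth.
- exact: mA.
rewrite /=; congr (product_measure1 _ _ _).
apply/seteqP; split=> [[x t] /= h|[x t] /= [Ax At] i].
  split; first by have := h ord0; rewrite tnth0.
  by move=> i; have := h (lift ord0 i); rewrite tnthS.
by case: (unliftP ord0 i) => [j|] ->; rewrite ?tnth0// tnthS.
Qed.

(* Half-vectorization: the entry (i, j), j <= i, of a symmetric matrix is stored
   at position i (i + 1) / 2 + j. *)
Definition sym_mx (R : realType) (d : nat) (t : ('C(d.+1, 2)).-tuple R) :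
    'M[R]_d :=
  \matrix_(i, j) t`_('C((maxn i j).+1, 2) + minn i j).

Lemma sym_mx_index d (i j : 'I_d) :
  ('C((maxn i j).+1, 2) + minn i j < 'C(d.+1, 2))%N.
Proof.
have md : (maxn i j < d)%N by rewrite gtn_max !ltn_ord.
apply: (@leq_trans 'C((maxn i j).+2, 2)); last first.
  by apply: leq_bin2l.
rewrite [leqRHS]binS bin1 ltn_add2l ltnS.
by rewrite (leq_trans (geq_minl i j))// leq_maxl.
Qed.

Lemma measurable_sym_mx (R : realType) d : measurable_fun setT (@sym_mx R d).
Proof.
apply/measurable_fun_matrixP => i j.
rewrite (_ : (fun _ => _) = @tnth _ R ^~ (Ordinal (sym_mx_index i j))).
  exact: measurable_tnth.
by apply/funext => t; rewrite mxE (tnth_nth 0).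
Qed.

Section lebesgue_sym.
Context (R : realType) (d : nat).

(* The measure dX = \prod_(i <= j) dx_ij on symmetric matrices, extended by 0 to
   all matrices. *)
Definition lebesgue_sym : set 'M[R]_d -> \bar R :=
  pushforward (@lebesgue_tuple R 'C(d.+1, 2)) (@sym_mx R d).

Let lebesgue_sym0 : lebesgue_sym set0 = 0%E.
Proof. by rewrite /lebesgue_sym /pushforward preimage_set0 measure0. Qed.

Let lebesgue_sym_ge0 A : (0 <= lebesgue_sym A)%E.
Proof. exact: (measure_ge0 (@lebesgue_tuple R 'C(d.+1, 2))). Qed.

Let lebesgue_sym_sigma_additive : semi_sigma_additive lebesgue_sym.
Proof.
exact: (@measure_semi_sigma_additive _ _ _
  (measure_function_pushforward__canonical__measure_function_Measure
     (@lebesgue_tuple R 'C(d.+1, 2)) (@measurable_sym_mx R d))).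
Qed.

HB.instance Definition _ := isMeasure.Build _ _ _ lebesgue_sym
  lebesgue_sym0 lebesgue_sym_ge0 lebesgue_sym_sigma_additive.

End lebesgue_sym.

Section wishart.
Context (R : realType) (d : nat).

Definition posdefmx : set 'M[R]_d :=
  [set X | X^T = X /\
           forall v : 'cV[R]_d, v != 0 -> 0 < (v^T *m X *m v) 0 0].

Definition multivariate_gamma (nu : R) : R :=
  \int[@lebesgue_sym R d]_(X in posdefmx)
    (expR (- \tr X) * \det X `^ (nu - d.+1%:R / 2)).

Definition wishart_density (alpha : R) (Sigma X : 'M[R]_d) : R :=
  \det X `^ (alpha / 2 - d.+1%:R / 2) * expR (- \tr (invmx Sigma *m X) / 2) /
  (\det (2 *: Sigma) `^ (alpha / 2) * multivariate_gamma (alpha / 2)).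

(* Only its values on measurable sets are meaningful. *)
Definition wishart (alpha : R) (Sigma : 'M[R]_d) (A : set 'M[R]_d) : \bar R :=
  (\int[@lebesgue_sym R d]_(X in A `&` posdefmx)
     (wishart_density alpha Sigma X)%:E)%E.

End wishart.

Definition mutually_independent (R : realType) d d' (Omega : measurableType d)
    (T : measurableType d') (P : probability Omega R)
    (X : nat -> {RV P >-> T}) : Prop :=
  forall (J : {fset nat}) (A : nat -> set T),
    (forall i, measurable (A i)) ->
    P (\bigcap_(i in [set` J]) X i @^-1` A i) =
    (\prod_(i <- J) P (X i @^-1` A i))%E.

Section structured_stein.
Context (R : realType).

(* The library norm on matrices is the sup norm. *)
Definition norm2 m (v : 'cV[R]_m) : R := Num.sqrt (\sum_i v i 0 ^+ 2).

Definition argmin T (f : T -> R) : set T := [set x | forall x', f x <= f x'].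

Context (d p M : nat) (B : 'I_p -> 'M[R]_d) (U : 'I_M -> 'M[R]_d).

Definition linear_scale (beta : 'cV[R]_p) : 'M[R]_d :=
  \sum_j beta j 0 *: B j.

Definition stein_lhs (beta : 'cV[R]_p) : 'cV[R]_M :=
  \col_m \tr (linear_scale beta *m U m).

(* The sample is X 0, ..., X n.-1. *)
Definition stein_rhs (alpha : R) (X : nat -> 'M[R]_d) (n : nat) : 'cV[R]_M :=
  \col_m ((alpha * n%:R)^-1 * \sum_(k < n) \tr (X k *m U m)).

Definition design_mx : 'M[R]_(M, p) := \matrix_(m, j) \tr (B j *m U m).

Definition least_squares (C : 'M[R]_(M, p)) (y : 'cV[R]_M) : 'cV[R]_p :=
  invmx (C^T *m C) *m C^T *m y.

End structured_stein.

(* Main.v *)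
(* The substitution X -> A X A^T has Jacobian |A|^(d+1) on symmetric matrices and
   multiplies the Wishart density by |A|^(alpha-d-1) expR (- h_A X), where
   2 h_A X = tr (Sigma^-1 A X A^T) - tr (Sigma^-1 X).  As the density integrates to
   one, E expR (- h_A (W k)) = |A|^(-alpha), without any moment or Gamma function
   computation.  By Chernoff's bound and Borel-Cantelli, the averages of h_A (W k)
   are then asymptotically at least alpha ln |A|, almost surely.  For A = c I, c < 1,
   this bounds the averages of tr (Sigma^-1 W k), hence those of all entries of W k.
   For A = I + t E_ij, one has h_A X = t (Sigma^-1 X)_ij + O(t^2) tr (Sigma^-1 X),
   and t -> 0 with both signs shows that the averages of (Sigma^-1 W k)_ij tend to
   alpha delta_ij: this is the law of large numbers for the sample.  The
   least-squares solution is a fixed linear function of the sample mean. *)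
Require Import Defs.
From HB Require Import structures.
From mathcomp Require Import all_boot all_order all_algebra finmap.
From mathcomp Require Import all_classical all_reals all_analysis.
From mathcomp Require Import measurable_realfun ring lra zify.

Import Order.TTheory GRing.Theory Num.Theory.
Import numFieldNormedType.Exports.

Local Open Scope classical_set_scope.
Local Open Scope ring_scope.

Set Implicit Arguments.
Unset Strict Implicit.

(** * Positive definite matrices: Schur complements, Cholesky factors, entry bounds *)

Section posdef.
Context (R : realType).

Lemma quad_formE n (X : 'M[R]_n) (v : 'cV[R]_n) :
  (v^T *m X *m v) 0 0 = \sum_i \sum_j v i 0 * X i j * v j 0.
Proof.
rewrite mxE exchange_big /=; apply: eq_bigr => j _.
rewrite mxE mulr_suml; apply: eq_bigr => i _; by rewrite mxE.
Qed.

(* The Schur complement of the top left entry, multiplied by that entry: this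
   keeps it polynomial in X. *)
Definition schur n (X : 'M[R]_(1 + n)) : 'M[R]_n :=
  X 0 0 *: drsubmx X - dlsubmx X *m ursubmx X.

Lemma schurE n (X : 'M[R]_(1 + n)) i j :
  schur X i j = X 0 0 * X (rshift 1 i) (rshift 1 j)
                - X (rshift 1 i) 0 * X 0 (rshift 1 j).
Proof.
rewrite !mxE big_ord_recl big_ord0 addr0 !mxE.
by rewrite (_ : lshift n 0 = 0)//; exact/val_inj.
Qed.

(** Completing the square in the first coordinate of [v]; by symmetry of [X] the two cross terms are
    equal. *)
Lemma quad_form_schur n (X : 'M[R]_(1 + n)) (v : 'cV[R]_(1 + n)) : X^T = X ->
  X 0 0 * (v^T *m X *m v) 0 0 = (\sum_j X 0 j * v j 0) ^+ 2 +
    ((dsubmx v)^T *m schur X *m dsubmx v) 0 0.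
Proof.
move=> Xs; have sX i j : X i j = X j i by rewrite -[in LHS]Xs mxE.
rewrite !quad_formE !big_ord_recl.
under [X in _ * (_ + X)]eq_bigr do rewrite big_ord_recl.
rewrite big_split /=.
pose b := \sum_(i < n) X 0 (lift ord0 i) * v (lift ord0 i) 0.
have -> : \sum_(i < n) v 0 0 * X 0 (lift ord0 i) * v (lift ord0 i) 0 = v 0 0 * b.
  by rewrite mulr_sumr; apply: eq_bigr => i _; ring.
have -> : \sum_(i < n) v (lift ord0 i) 0 * X (lift ord0 i) 0 * v 0 0 = v 0 0 * b.
  by rewrite mulr_sumr; apply: eq_bigr => i _; rewrite sX; ring.
rewrite -/b.
have rE (i : 'I_n) : rshift 1 i = lift ord0 i by exact/val_inj.
under [X in _ = _ + X]eq_bigr => i _.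
  under eq_bigr => j _ do rewrite schurE !mxE (sX (rshift 1 i) 0) !rE
    mulrBr mulrBl.
  rewrite sumrB.
  over.
rewrite sumrB.
have -> : \sum_(i < n) \sum_(j < n) v (lift ord0 i) 0 *
   (X 0 (lift ord0 i) * X 0 (lift ord0 j)) * v (lift ord0 j) 0 = b * b.
  rewrite mulr_suml; apply: eq_bigr => i _.
  by rewrite mulr_sumr; apply: eq_bigr => j _; ring.
set u := (X in _ * (_ + (_ + X))).
rewrite (_ : \sum_(i < n) \sum_(j < n) _ = X 0 0 * u); first by ring.
rewrite mulr_sumr; apply: eq_bigr => i _.
by rewrite mulr_sumr; apply: eq_bigr => j _; ring.
Qed.

(** A recursion on the dimension, which serves both the Cholesky factorization and measurability.
    Both directions read off signs from [quad_form_schur]. *)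
Lemma posdefmx_schur n (X : 'M[R]_(1 + n)) :
  posdefmx X <-> [/\ X^T = X, 0 < X 0 0 & posdefmx (schur X)].
Proof.
split=> [[Xs Xp]|[Xs a0 [_ Sp]]].
- have sX i j : X i j = X j i by rewrite -[in LHS]Xs mxE.
  have a0 : 0 < X 0 0.
    have := Xp (delta_mx 0 0); rewrite trmx_delta -colE -rowE !mxE; apply.
    by apply/eqP => /matrixP/(_ 0 0); rewrite !mxE !eqxx /= => /eqP; rewrite oner_eq0.
  split=> //; split.
    by apply/matrixP => i j; rewrite mxE !schurE (sX (rshift 1 j) (rshift 1 i))
      (sX (rshift 1 j) 0) (sX 0 (rshift 1 i)); congr (_ - _); exact: mulrC.
  move=> w w0.
  pose b := \sum_(i < n) X 0 (rshift 1 i) * w i 0.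
  (* The first coordinate is chosen to make the square in [quad_form_schur] vanish. *)
  pose v : 'cV[R]_(1 + n) := col_mx (- (X 0 0)^-1 * b)%:M w.
  have vE : \sum_j X 0 j * v j 0 = 0.
    rewrite big_split_ord/= big_ord_recl big_ord0 addr0 col_mxEu mxE/=.
    under eq_bigr do rewrite col_mxEd.
    rewrite -/b (_ : lshift n ord0 = 0); last exact/val_inj.
    by rewrite mulr1n mulrA mulrN divff ?gt_eqF// mulN1r addNr.
  have := quad_form_schur v Xs; rewrite vE expr0n/= add0r col_mxKd => <-.
  apply: mulr_gt0 => //; apply: Xp; apply: contra w0 => /eqP v0.
  by rewrite -(col_mxKd (- (X 0 0)^-1 * b)%:M w) -/v v0 linear0.
split=> // v v0; rewrite -(pmulr_rgt0 _ a0) quad_form_schur//.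
(* If the lower part of [v] vanishes, positivity comes from the square alone, which reduces to that
   of [X 0 0 * v 0 0]. *)
have [w0|w0] := eqVneq (dsubmx v) 0; last first.
  by apply: ltr_wpDl; [exact: sqr_ge0|exact: Sp].
rewrite w0 mulmx0 mxE addr0 lt_neqAle sqr_ge0 andbT eq_sym sqrf_eq0.
rewrite big_ord_recl big1 ?addr0 => [|i _]; last first.
  have -> : lift ord0 i = rshift 1 i by exact/val_inj.
  by have /matrixP/(_ i 0) := w0; rewrite !mxE => ->; rewrite mulr0.
apply: mulf_neq0; first by rewrite gt_eqF.
apply: contra v0 => /eqP s0.
rewrite -[v]vsubmxK w0; apply/eqP/matrixP => i j; rewrite !ord1 !mxE.
case: split_ordP => k _; rewrite !mxE//.
by rewrite ord1 (_ : lshift n 0 = ord0)//; exact/val_inj.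
Qed.

(** Induction through the Schur complement gives the factor. It is invertible because a row vector
    in its left kernel would annul the quadratic form of [X]. *)
Lemma posdefmx_cholesky n (X : 'M[R]_n) : posdefmx X ->
  exists2 A : 'M[R]_n, A \in unitmx & X = A *m A^T.
Proof.
move=> Xp; suff [A XA] : exists A : 'M[R]_n, X = A *m A^T.
  exists A => //; rewrite -row_free_unit -kermx_eq0.
  apply/negP => /negP /rowV0Pn[v /sub_kermxP vA v0].
  have vT0 : v^T != 0.
    by apply: contra v0 => /eqP h; rewrite -[v]trmxK h trmx0.
  by have := Xp.2 v^T vT0; rewrite trmxK XA mulmxA vA !mul0mx mxE ltxx.
elim: n X Xp => [|n IH] X Xp; first by exists 0; apply/matrixP => -[].
have /(posdefmx_schur (n := n))[Xs a0 /IH[G SG]] := Xp.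
pose Y : 'M[R]_(1 + n) := X; pose s := Num.sqrt (X 0 0).
change (exists A : 'M[R]_(1 + n), Y = A *m A^T).
have s0 : s != 0 by rewrite gt_eqF// sqrtr_gt0.
have ss : s * s = X 0 0 by rewrite -expr2 sqr_sqrtr// ltW.
(* [schur] carries an extra factor [X 0 0], that is [s ^+ 2], hence the scaling of [G] by [s^-1]. *)
exists (block_mx s%:M 0 (s^-1 *: dlsubmx Y) (s^-1 *: G)).
rewrite -[LHS]submxK tr_block_mx mulmx_block.
rewrite !(trmx0, mulmx0, mul0mx, addr0, add0r).
rewrite !linearZ/= -!scalemxAl !scalerA -SG.
rewrite tr_scalar_mx -!scalar_mxM mul_mx_scalar mul_scalar_mx !scalerA.
have Yt : (dlsubmx Y)^T = ursubmx Y by rewrite trmx_dlsub; congr ursubmx.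
rewrite Yt mulVf// !scale1r ss -invfM ss.
congr block_mx.
  apply/matrixP => i j; rewrite !ord1 !mxE eqxx mulr1n; congr (X _ _); exact/val_inj.
rewrite /schur scalerBr scalerA mulVf ?gt_eqF// scale1r.
by rewrite addrC subrK.
Qed.

Lemma posdefmx_det_gt0 n (X : 'M[R]_n) : posdefmx X -> 0 < \det X.
Proof.
move=> /posdefmx_cholesky[A]; rewrite unitmxE unitfE => A0 ->.
by rewrite det_mulmx det_tr -expr2 lt_neqAle sqr_ge0 eq_sym sqrf_eq0 A0.
Qed.

Lemma posdefmx_congr n (A X : 'M[R]_n) : A \in unitmx ->
  posdefmx (A *m X *m A^T) <-> posdefmx X.
Proof.
have imp (B Y : 'M[R]_n) : B \in unitmx -> posdefmx Y -> posdefmx (B *m Y *m B^T).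
  move=> Bu [Ys Yp]; split; first by rewrite !trmx_mul trmxK Ys mulmxA.
  move=> v v0; rewrite !mulmxA -mulmxA -[v^T *m B]trmxK trmx_mul trmxK.
  apply: Yp; apply: contra v0 => /eqP h.
  by rewrite -[v](@mulKmx _ _ _ B^T) ?unitmx_tr// h mulmx0.
move=> Au; split; last exact: imp.
move=> /(imp (invmx A)); rewrite unitmx_inv => /(_ Au).
by rewrite -!mulmxA -trmx_mul mulVmx// trmx1 mulmx1 mulmxA mulVmx// mul1mx.
Qed.

(** With [X = A *m A^T] the entries are inner products of rows of [A], so each is bounded by the
    mean of two diagonal entries, which are nonnegative and sum to the trace. *)
Lemma posdefmx_entry_le n (X : 'M[R]_n) i j : posdefmx X -> `|X i j| <= \tr X.
Proof.
move=> /posdefmx_cholesky[A _ ->].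
have dE k : (A *m A^T) k k = \sum_l A k l ^+ 2.
  by rewrite mxE; apply: eq_bigr => l _; rewrite mxE expr2.
have d0 k : 0 <= (A *m A^T) k k by rewrite dE; apply: sumr_ge0 => l _; exact: sqr_ge0.
have dle k : (A *m A^T) k k <= \tr (A *m A^T).
  by rewrite /mxtrace (bigD1 k)//= lerDl; exact: sumr_ge0.
have h : `|(A *m A^T) i j| <= ((A *m A^T) i i + (A *m A^T) j j) / 2.
  rewrite !dE -big_split/= mxE; apply: (le_trans (ler_norm_sum _ _ _)).
  rewrite mulr_suml; apply: ler_sum => l _; rewrite mxE ler_norml.
  by have := sqr_ge0 (A i l + A j l); have := sqr_ge0 (A i l - A j l); nra.
by have := dle i; have := dle j; lra.
Qed.

(* Writing S = A A^T, the matrix A^-1 X A^-T is positive definite with trace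
   tr (S^-1 X). *)
Lemma posdefmx_entry_le_tr n (S : 'M[R]_n) : posdefmx S ->
  exists2 K : R, 0 <= K & forall X, posdefmx X -> forall i j,
    `|X i j| <= K * \tr (invmx S *m X).
Proof.
move=> /posdefmx_cholesky[A Au SA].
pose K i j := \sum_k \sum_l `|A i k| * `|A j l|.
have K0 i j : 0 <= K i j by do 2 apply: sumr_ge0 => ? _; exact: mulr_ge0.
exists (\sum_i \sum_j K i j); first by do 2 apply: sumr_ge0 => ? _.
move=> X Xp i j; pose Y := invmx A *m X *m (invmx A)^T.
have Yp : posdefmx Y by apply/posdefmx_congr; rewrite ?unitmx_inv.
have trY : \tr Y = \tr (invmx S *m X).
  have Su : S \in unitmx by rewrite SA unitmx_mul unitmx_tr Au.
  rewrite (_ : invmx S = (invmx A)^T *m invmx A).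
    by rewrite /Y mxtrace_mulC mulmxA.
  rewrite -[RHS](mulKmx Su) SA -mulmxA [A^T *m _]mulmxA -trmx_mul.
  by rewrite mulVmx// trmx1 mul1mx mulmxV// mulmx1.
have XY : X = A *m Y *m A^T.
  rewrite /Y -!mulmxA -trmx_mul mulmxV// trmx1 mulmx1.
  by rewrite mulmxA mulmxV// mul1mx.
have trY0 : 0 <= \tr Y by apply: le_trans (posdefmx_entry_le i i Yp).
have KK : K i j <= \sum_i \sum_j K i j.
  rewrite (bigD1 i)//= (bigD1 j)//= -addrA lerDl addr_ge0//.
    exact: sumr_ge0.
  by do 2 apply: sumr_ge0 => ? _.
rewrite -trY; apply: (le_trans _ (ler_wpM2r trY0 KK)).
rewrite {1}XY mxE mulr_suml.
apply: (le_trans (ler_norm_sum _ _ _)).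
rewrite /K; under [leRHS]eq_bigr do rewrite mulr_suml.
rewrite [leRHS]exchange_big/=; apply: ler_sum => l _.
rewrite !mxE mulr_suml; apply: (le_trans (ler_norm_sum _ _ _)).
apply: ler_sum => k _; rewrite !normrM mulrAC.
by apply: ler_wpM2l; rewrite ?mulr_ge0//; exact: posdefmx_entry_le.
Qed.

End posdef.

(** * Measurability of matrix operations and of the positive definite cone *)

Section measurable_mx.
Context (R : realType).

Lemma measurable_mx_entry m n i j :
  measurable_fun setT (fun X : 'M[R]_(m, n) => X i j).
Proof. exact: (measurable_fun_matrixP id).1. Qed.

Context d (T : measurableType d).

Lemma measurable_mulmx m n p (f : T -> 'M[R]_(m, n)) (g : T -> 'M[R]_(n, p)) :
  measurable_fun setT f -> measurable_fun setT g ->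
  measurable_fun setT (fun x => f x *m g x).
Proof.
move=> /measurable_fun_matrixP mf /measurable_fun_matrixP mg.
apply/measurable_fun_matrixP => i j; under eq_fun do rewrite mxE.
by apply: measurable_sum => k; exact: measurable_funM.
Qed.

Lemma measurable_mxtrace n (f : T -> 'M[R]_n) :
  measurable_fun setT f -> measurable_fun setT (fun x => \tr (f x)).
Proof. by move=> /measurable_fun_matrixP mf; exact: measurable_sum. Qed.

Lemma measurable_det n (f : T -> 'M[R]_n) :
  measurable_fun setT f -> measurable_fun setT (fun x => \det (f x)).
Proof.
move=> /measurable_fun_matrixP mf; apply: measurable_sum => s.
apply: measurable_funM; first exact: measurable_cst.
by apply: measurable_prod => i _.
Qed.

End measurable_mx.

(** The definition imposes one condition per vector, an uncountable family; the Schur recursion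
    replaces it by finitely many measurable conditions. *)
Lemma measurable_posdefmx (R : realType) n : measurable (@posdefmx R n).
Proof.
elim: n => [|n IH].
  rewrite (_ : @posdefmx R 0 = setT)//; apply/seteqP; split=> // X _; split.
    by apply/matrixP => -[].
  by move=> v /eqP[]; apply/matrixP => -[].
have mE i j : measurable_fun setT (fun X : 'M[R]_(1 + n) => X i j).
  exact: measurable_mx_entry.
rewrite (_ : @posdefmx R n.+1 = (\bigcap_(i in [set: 'I_(1 + n)])
    \bigcap_(j in [set: 'I_(1 + n)])
      (fun X : 'M[R]_(1 + n) => X i j - X j i) @^-1` [set 0]) `&`
   ((fun X : 'M[R]_(1 + n) => X 0 0) @^-1` `]0, +oo[ `&`
    @schur R n @^-1` @posdefmx R n)); last first.
  apply/seteqP; split=> X /=.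
    move=> /(posdefmx_schur (n := n))[Xs a0 Sp]; split; last first.
      by rewrite in_itv/= a0.
    by move=> i _ j _ /=; rewrite -[in X in _ - X]Xs mxE subrr.
  move=> [Xs [a0 Sp]]; apply/(posdefmx_schur (n := n)); split=> //.
    by apply/matrixP => i j; rewrite mxE; apply/eqP; rewrite -subr_eq0; apply/eqP/Xs.
  by move: a0; rewrite in_itv/= andbT.
apply: measurableI; last apply: measurableI.
- apply: fin_bigcap_measurable => // i _; apply: fin_bigcap_measurable => // j _.
  rewrite -[X in measurable X]setTI; apply: measurable_funB => //.
- by rewrite -[X in measurable X]setTI; exact: mE.
- rewrite -[X in measurable X]setTI.
  suff : measurable_fun setT (@schur R n) by exact.
  apply/measurable_fun_matrixP => i j; under eq_fun do rewrite schurE.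
  by apply: measurable_funB; apply: measurable_funM.
Qed.

(** * Affine changes of one real variable *)

Section lebesgue_affine.
Context (R : realType).
Local Notation leb := (@lebesgue_measure R).
Local Open Scope ereal_scope.

(** By uniqueness of Lebesgue measure it suffices to compare both sides on the intervals []x,
    y]]. *)
Lemma lebesgue_measure_affine (c b : R) (A : set (measurableTypeR R)) :
  (0 < c)%R -> measurable A ->
  leb A = c%:E * leb ((fun x => c * x + b)%R @^-1` A).
Proof.
move=> c0 mA.
pose f (x : measurableTypeR R) : measurableTypeR R := (c * x + b)%R.
have mf : measurable_fun setT f.
  by apply: measurable_funD => //; exact: measurable_funM.
pose nu : {measure set (measurableTypeR R) -> \bar R} :=
  measure_function_pushforward__canonical__measure_function_Measure leb mf.
pose nuc : {measure set (measurableTypeR R) -> \bar R} :=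
  mscale (NngNum (ltW c0)) nu.
rewrite (@lebesgue_measure_unique _ nuc)// => X /ocitvP[->|[[x y] /= xy ->]].
  by rewrite !measure0.
rewrite [RHS]/= /mscale/= /pushforward.
rewrite (_ : _ @^-1` _ = `](c^-1 * (x - b))%R, (c^-1 * (y - b))%R]%classic).
  rewrite !lebesgue_measure_itv/= !lte_fin ltr_pM2l ?invr_gt0// ltrD2r xy.
  by rewrite -!EFinD -EFinM; congr EFin; rewrite -mulrBr mulVKf ?gt_eqF//; lra.
apply/seteqP; split=> z /=; rewrite !in_itv/= /f => /andP[h1 h2]; apply/andP; split.
- by rewrite mulrC ltr_pdivrMr// ; lra.
- by rewrite mulrC ler_pdivlMr// ; lra.
- by move: h1; rewrite mulrC ltr_pdivrMr//; lra.
- by move: h2; rewrite mulrC ler_pdivlMr//; lra.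
Qed.

Lemma ge0_integral_lebesgue_affine (c b : R) (F : R -> \bar R) : (0 < c)%R ->
  measurable_fun setT F -> (forall x, 0 <= F x) ->
  \int[leb]_x F x = c%:E * \int[leb]_x F (c * x + b)%R.
Proof.
move=> c0 mF F0.
pose f (x : measurableTypeR R) : measurableTypeR R := (c * x + b)%R.
have mf : measurable_fun setT f.
  by apply: measurable_funD => //; exact: measurable_funM.
pose nu : {measure set (measurableTypeR R) -> \bar R} :=
  measure_function_pushforward__canonical__measure_function_Measure leb mf.
pose c' : {nonneg R} := NngNum (ltW c0).
rewrite (eq_measure_integral (mscale c' nu)) => [|A mA _]; last first.
  exact: lebesgue_measure_affine.
by rewrite ge0_integral_mscale// ge0_integral_pushforward.
Qed.

End lebesgue_affine.

(** * Affine changes of one coordinate of a tuple *)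

Section lebesgue_tuple_affine.
Context (R : realType).

Definition tset n (t : n.-tuple R) (a : 'I_n) (z : R) : n.-tuple R :=
  [tuple if i == a then z else tnth t i | i < n].

Lemma tnth_tset n (t : n.-tuple R) a z i :
  tnth (tset t a z) i = if i == a then z else tnth t i.
Proof. by rewrite tnth_mktuple. Qed.

Lemma measurable_tset d (T : measurableType d) n (f : T -> n.-tuple R) a
    (g : T -> R) : measurable_fun setT f -> measurable_fun setT g ->
  measurable_fun setT (fun x => tset (f x) a (g x)).
Proof.
move=> mf mg; apply/measurable_fun_tnthP => i.
rewrite (_ : _ \o _ = fun x => if i == a then g x else tnth (f x) i); last first.
  by apply/funext => x /=; rewrite tnth_tset.
case: (i == a) => //; exact: (measurableT_comp (@measurable_tnth _ R n i) mf).
Qed.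

Lemma tset_cons0 n x (t : n.-tuple R) z :
  tset [tuple of x :: t] ord0 z = [tuple of z :: t].
Proof.
apply: eq_from_tnth => i; rewrite tnth_tset.
by have [j ->|->] := unliftP ord0 i; rewrite ?tnth0// !tnthS.
Qed.

Lemma tset_consS n x (t : n.-tuple R) a z :
  tset [tuple of x :: t] (lift ord0 a) z = [tuple of x :: tset t a z].
Proof.
apply: eq_from_tnth => i; rewrite tnth_tset.
have [j ->|->] := unliftP ord0 i; rewrite ?tnth0//.
by rewrite !tnthS tnth_tset (inj_eq lift_inj).
Qed.

Local Open Scope ereal_scope.

Lemma ge0_integral_lebesgue_tupleS n (F : n.+1.-tuple R -> \bar R) :
  measurable_fun setT F -> (forall t, 0 <= F t) ->
  \int[@lebesgue_tuple R n.+1]_t F t =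
  \int[(@lebesgue_measure R \x @lebesgue_tuple R n)]_xt F [tuple of xt.1 :: xt.2].
Proof.
move=> mF F0.
pose pm : {measure set (n.+1.-tuple R) -> \bar R} :=
  measure_function_pushforward__canonical__measure_function_Measure
    (lebesgue_measure \x @lebesgue_tuple R n) (@measurable_cons_tuple R n).
rewrite (eq_measure_integral pm) => [|A mA _]; last by [].
rewrite ge0_integral_pushforward//; first exact: measurable_cons_tuple.
Qed.

(** The last hypothesis says that [g] does not depend on coordinate [a], so with the other
    coordinates frozen this is an affine change of one variable. Tonelli's theorem peels off the
    head. *)
Lemma ge0_integral_lebesgue_tuple_affine n (F : n.-tuple R -> \bar R) (a : 'I_n)
    (c : R) (g : n.-tuple R -> R) : (0 < c)%R ->
  measurable_fun setT F -> (forall t, 0 <= F t) ->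
  measurable_fun setT g -> (forall t z, g (tset t a z) = g t) ->
  \int[@lebesgue_tuple R n]_t F t =
  c%:E * \int[@lebesgue_tuple R n]_t F (tset t a (c * tnth t a + g t)%R).
Proof.
move=> c0; elim: n => [|n IH] in F a g *; first by case: a.
move=> mF F0 mg gE.
have mG m (H : m.-tuple R -> \bar R) b (h : m.-tuple R -> R) :
    measurable_fun setT H -> measurable_fun setT h ->
    measurable_fun setT (fun t => H (tset t b (c * tnth t b + h t)%R)).
  move=> mH mh; apply: (measurableT_comp mH); apply: measurable_tset => //.
  apply: measurable_funD => //; apply: measurable_funM => //.
  exact: measurable_tnth.
have mcons (H : n.+1.-tuple R -> \bar R) : measurable_fun setT H ->
    measurable_fun setT (fun xt : measurableTypeR R * n.-tuple R =>
      H [tuple of xt.1 :: xt.2]).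
  by move=> mH; exact: (measurableT_comp mH (@measurable_cons_tuple R n)).
have mcons1 (x : R) : measurable_fun setT (fun t : n.-tuple R => [tuple of x :: t]).
  exact: (@measurable_cons _ _ (n.-tuple R) R (cst x) n id).
have mcons2 (t : n.-tuple R) : measurable_fun setT (fun x : R => [tuple of x :: t]).
  exact: (@measurable_cons _ _ R R id n (cst t)).
have mFcons1 x := measurableT_comp mF (mcons1 x).
have mFcons2 t := measurableT_comp mF (mcons2 t).
rewrite !ge0_integral_lebesgue_tupleS//; last exact: mG.
have [a' aE|aE] := unliftP ord0 a; rewrite aE.
(* Coordinate [a] lies in the tail: integrate over the tail first and use induction. *)
- rewrite !fubini_tonelli1//=; last 2 first.
  + by rewrite -aE; exact: (mcons _ (mG _ F a g mF mg)).
  + exact: mcons.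
  rewrite -ge0_integralZl//; last 3 first.
  + apply: measurable_fun_fubini_tonelli_F => //.
    by rewrite -aE; exact: (mcons _ (mG _ F a g mF mg)).
  + by move=> x _; exact: integral_ge0.
  + by rewrite lee_fin ltW.
  apply: eq_integral => x _; rewrite /fubini_F/=.
  rewrite (IH (fun t => F [tuple of x :: t]) a' (fun t => g [tuple of x :: t]))//.
  + by congr (_ * _); apply: eq_integral => t _; rewrite tset_consS tnthS.
  + exact: mFcons1.
  + exact: (measurableT_comp mg (mcons1 x)).
  + by move=> t z; rewrite -tset_consS -aE gE.
(* Coordinate [a] is the head: integrate over it first, with the tail fixed. *)
- rewrite !fubini_tonelli2//=; last 2 first.
  + by rewrite -aE; exact: (mcons _ (mG _ F a g mF mg)).
  + exact: mcons.
  rewrite -ge0_integralZl//; last 3 first.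
  + apply: measurable_fun_fubini_tonelli_G => //.
    by rewrite -aE; exact: (mcons _ (mG _ F a g mF mg)).
  + by move=> x _; exact: integral_ge0.
  + by rewrite lee_fin ltW.
  apply: eq_integral => t _; rewrite /fubini_G/=.
  (* The offset does not depend on the head, so it is evaluated with head 0. *)
  rewrite (@ge0_integral_lebesgue_affine R c (g [tuple of 0%R :: t]) _ c0)//; last first.
    exact: mFcons2.
  congr (_ * _); apply: eq_integral => x _; rewrite tset_cons0 tnth0.
  by rewrite -(gE [tuple of x :: t] 0%R) aE tset_cons0.
Qed.

End lebesgue_tuple_affine.

(** * Change of variables for congruences by row replacements *)

Section lebesgue_sym_congruence.
Context (R : realType).

(** Each row of the stored triangle ends before the next one starts, so a position determines the
    maximum of the two indices, then their minimum. *)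
Lemma sym_mx_index_inj d (i j k l : 'I_d) :
  ('C((maxn i j).+1, 2) + minn i j = 'C((maxn k l).+1, 2) + minn k l)%N ->
  (i = k /\ j = l) \/ (i = l /\ j = k).
Proof.
have lt (a b c e : 'I_d) : (maxn a b < maxn c e)%N ->
    ('C((maxn a b).+1, 2) + minn a b < 'C((maxn c e).+1, 2) + minn c e)%N.
  move=> h; apply: (@leq_trans 'C((maxn a b).+2, 2)).
    rewrite [ltnRHS]binS bin1 ltn_add2l ltnS.
    by rewrite (leq_trans (geq_minl a b))// leq_maxl.
  by apply: (leq_trans _ (leq_addr _ _)); apply: leq_bin2l.
case: (ltngtP (maxn i j) (maxn k l)) => [/lt h e|/lt h e|e].
- by rewrite e ltnn in h.
- by rewrite e ltnn in h.
rewrite e => /addnI m.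
have [ik|ik] : nat_of_ord i = k \/ nat_of_ord i = l by lia.
  by left; split; apply/val_inj => //=; lia.
by right; split; apply/val_inj => //=; lia.
Qed.

Lemma sym_mxT d (t : ('C(d.+1, 2)).-tuple R) : (sym_mx t)^T = (sym_mx t : 'M[R]_d).
Proof. by apply/matrixP => i j; rewrite !mxE maxnC minnC. Qed.

(** The matrix counterpart of [tset]: one stored coordinate appears at both mirror positions. *)
Definition mset d (X : 'M[R]_d) (i k : 'I_d) (z : R) : 'M[R]_d :=
  \matrix_(a, b) if (a == i) && (b == k) || (a == k) && (b == i) then z else X a b.

Lemma sym_mx_tset d (t : ('C(d.+1, 2)).-tuple R) (i k : 'I_d) z :
  sym_mx (tset t (Ordinal (sym_mx_index i k)) z) = mset (sym_mx t) i k z.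
Proof.
apply/matrixP => a b; rewrite !mxE.
rewrite -!(tnth_nth 0 _ (Ordinal (sym_mx_index a b))) tnth_tset.
congr (if _ then _ else _); apply/eqP/orP => [/(congr1 val)/= /sym_mx_index_inj|].
  by move=> [[-> ->]|[-> ->]]; [left|right]; rewrite !eqxx.
by move=> [/andP[/eqP-> /eqP->]|/andP[/eqP-> /eqP->]]; apply/val_inj => //=;
  rewrite maxnC minnC.
Qed.

Lemma measurable_mset d' (T : measurableType d') d (f : T -> 'M[R]_d) i k
    (g : T -> R) : measurable_fun setT f -> measurable_fun setT g ->
  measurable_fun setT (fun x => mset (f x) i k (g x)).
Proof.
move=> /measurable_fun_matrixP mf mg; apply/measurable_fun_matrixP => a b.
under eq_fun do rewrite mxE.
by case: (_ || _) => /=; [exact: mg|exact: mf].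
Qed.

Local Open Scope ereal_scope.

Lemma ge0_integral_lebesgue_sym d (F : 'M[R]_d -> \bar R) :
  measurable_fun setT F -> (forall X, 0 <= F X) ->
  \int[@lebesgue_sym R d]_X F X =
  \int[@lebesgue_tuple R 'C(d.+1, 2)]_t F (sym_mx t).
Proof.
move=> mF F0.
pose pm : {measure set 'M[R]_d -> \bar R} :=
  measure_function_pushforward__canonical__measure_function_Measure
    (@lebesgue_tuple R 'C(d.+1, 2)) (@measurable_sym_mx R d).
rewrite (eq_measure_integral pm) => [|A mA _]; last by [].
by rewrite ge0_integral_pushforward//; exact: measurable_sym_mx.
Qed.

Lemma ge0_eq_integral_lebesgue_sym d (F G : 'M[R]_d -> \bar R) :
  measurable_fun setT F -> (forall X, 0 <= F X) ->
  measurable_fun setT G -> (forall X, 0 <= G X) ->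
  (forall X, X^T = X -> F X = G X) ->
  \int[@lebesgue_sym R d]_X F X = \int[@lebesgue_sym R d]_X G X.
Proof.
move=> mF F0 mG G0 FG; rewrite !ge0_integral_lebesgue_sym//.
by apply: eq_integral => t _; rewrite FG// sym_mxT.
Qed.

Lemma ge0_integral_mset d (F : 'M[R]_d -> \bar R) (i k : 'I_d) (c : R)
    (g : 'M[R]_d -> R) : (0 < c)%R ->
  measurable_fun setT F -> (forall X, 0 <= F X) ->
  measurable_fun setT g -> (forall X z, g (mset X i k z) = g X) ->
  \int[@lebesgue_sym R d]_X F X =
  c%:E * \int[@lebesgue_sym R d]_X F (mset X i k (c * X i k + g X)%R).
Proof.
move=> c0 mF F0 mg gE.
have mG : measurable_fun setT (fun X => F (mset X i k (c * X i k + g X)%R)).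
  apply: (measurableT_comp mF); apply: measurable_mset => //.
  apply: measurable_funD => //; apply: measurable_funM => //.
  exact: measurable_mx_entry.
rewrite !ge0_integral_lebesgue_sym//.
rewrite (@ge0_integral_lebesgue_tuple_affine R _ _
    (Ordinal (sym_mx_index i k)) c (g \o @sym_mx R d))//.
- congr (_ * _); apply: eq_integral => t _.
  by rewrite sym_mx_tset/= [sym_mx t i k]mxE (tnth_nth 0%R).
- exact: (measurableT_comp mF (@measurable_sym_mx R d)).
- exact: (measurableT_comp mg (@measurable_sym_mx R d)).
- by move=> t z /=; rewrite sym_mx_tset gE.
Qed.

Section row_replacement.
Context (d : nat) (i : 'I_d) (r : 'I_d -> R).

(** One family that contains both the transvections and the scalings of a single diagonal entry. *)
Definition row_repl_mx : 'M[R]_d :=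
  \matrix_(a, b) if a == i then r b else (a == b)%:R.

Lemma row_repl_mul (X : 'M[R]_d) a b : (row_repl_mx *m X) a b =
  if a == i then (\sum_l r l * X l b)%R else X a b.
Proof.
rewrite mxE; case: ifPn => ai.
  by apply: eq_bigr => l _; rewrite mxE ai.
rewrite (bigD1 a)//= mxE (negbTE ai) eqxx mul1r big1 ?addr0// => l la.
by rewrite mxE (negbTE ai) eq_sym (negbTE la) mul0r.
Qed.

Lemma det_row_repl : \det row_repl_mx = r i.
Proof.
rewrite (expand_det_col _ i) (bigD1 i)//= mxE eqxx big1 ?addr0 => [|a ai].
  rewrite /cofactor (_ : row' i (col' i _) = 1%:M).
    by rewrite det1 addnn -signr_odd odd_double mulr1 mulr1.
  apply/matrixP => a b; rewrite !mxE eq_sym (negbTE (neq_lift _ _)).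
  by rewrite (inj_eq lift_inj).
by rewrite mxE (negbTE ai) mul0r.
Qed.

(** For [k != i] the entry [X i k] enters the new value with coefficient [r i] and nowhere else, so
    this is an affine change of one coordinate. *)
Let step k (X : 'M[R]_d) := mset X i k (\sum_l r l * X l k).

Let measurable_step k : measurable_fun setT (step k).
Proof.
apply: measurable_mset => //; apply: measurable_sum => l.
by apply: measurable_funM => //; exact: measurable_mx_entry.
Qed.

Let measurable_steps ks : measurable_fun setT (fun X => foldr step X ks).
Proof. by elim: ks => //= k ks IH; exact: (measurableT_comp (measurable_step k)). Qed.

(** The steps do not interfere: the step for [k] reads column [k], which the steps for the other
    indices leave unchanged. *)
Let foldr_stepE ks (X : 'M[R]_d) : uniq ks -> i \notin ks -> forall a b,
  foldr step X ks a b = if (a == i) && (b \in ks) then (\sum_l r l * X l b)%R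
    else if (b == i) && (a \in ks) then (\sum_l r l * X l a)%R else X a b.
Proof.
elim: ks => [_ _ a b|k ks IH /= /andP[kks uks]].
  by rewrite !in_nil !andbF.
rewrite inE negb_or => /andP[ik iks] a b; rewrite mxE !inE.
have -> : (\sum_l r l * foldr step X ks l k = \sum_l r l * X l k)%R.
  apply: eq_bigr => l _; rewrite IH// (negbTE kks) andbF.
  by rewrite eq_sym (negbTE ik).
rewrite IH//.
have [->|ai] := eqVneq a i; have [->|bi] := eqVneq b i;
  rewrite ?(negbTE ik) ?(negbTE iks) //=.
- by have [->|bk] := eqVneq b k; rewrite ?orbF.
- by have [->|bk] := eqVneq a k; rewrite ?orbF ?andbT.
- by rewrite !andbF.
Qed.

Hypothesis r0 : (0 < r i)%R.

Let ge0_integral_steps ks (F : 'M[R]_d -> \bar R) : i \notin ks ->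
  measurable_fun setT F -> (forall X, 0 <= F X) ->
  \int[@lebesgue_sym R d]_X F X =
  (r i ^+ size ks)%:E * \int[@lebesgue_sym R d]_X F (foldr step X ks).
Proof.
elim: ks F => [F _ mF F0|k ks IH F]; first by rewrite expr0 mul1e.
rewrite inE negb_or => /andP[ik iks] mF F0.
pose g (X : 'M[R]_d) := (\sum_(l | l != i) r l * X l k)%R.
rewrite (@ge0_integral_mset _ F i k _ g r0)//; last 2 first.
- rewrite /g; under eq_fun do rewrite big_mkcond/=.
  apply: measurable_sum => l; case: (l != i) => //.
  by apply: measurable_funM => //; exact: measurable_mx_entry.
- move=> X z; apply: eq_bigr => l li; rewrite mxE (negbTE li)/=.
  by rewrite [k == i]eq_sym (negbTE ik) andbF.
rewrite (_ : (fun X => F _) = F \o step k); last first.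
  by apply/funext => X/=; congr (F (mset _ _ _ _)); rewrite (bigD1 i).
rewrite (IH (F \o step k) iks)//; last 2 first.
- exact: (measurableT_comp mF (measurable_step k)).
- by move=> X; exact: F0.
by rewrite muleA -EFinM -exprS.
Qed.

(* Replacing the row i of X, then its column i, by the combination r amounts to
   an affine change of the entry (i, i) followed by one of each entry (i, k). *)
Lemma ge0_integral_row_repl (F : 'M[R]_d -> \bar R) :
  measurable_fun setT F -> (forall X, 0 <= F X) ->
  \int[@lebesgue_sym R d]_X F X = (\det row_repl_mx ^+ d.+1)%:E *
    \int[@lebesgue_sym R d]_X F (row_repl_mx *m X *m row_repl_mx^T).
Proof.
move=> mF F0; rewrite det_row_repl.
pose ks := [seq k <- enum 'I_d | k != i].
have iks : i \notin ks by rewrite mem_filter eqxx.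
have ksE k : (k \in ks) = (k != i) by rewrite mem_filter mem_enum andbT.
have uks : uniq ks by exact/filter_uniq/enum_uniq.
have sks : size ks = d.-1.
  have := count_predC (pred1 i) (enum 'I_d); rewrite size_enum_ord.
  by rewrite count_uniq_mem ?enum_uniq// mem_enum size_filter => /(congr1 predn) <-.
rewrite (ge0_integral_steps iks)//.
(* The new entry [(i, i)] is a quadratic expression in [r]: [X i i] has coefficient [r i ^+ 2] and
   [g] is the rest. With the factors [r i] of the [d.-1] steps this makes the power [d.+1]. *)
pose g (X : 'M[R]_d) :=
  (\sum_(lm : 'I_d * 'I_d | lm != (i, i)) r lm.1 * r lm.2 * X lm.1 lm.2)%R.
have c0 : (0 < r i ^+ 2)%R by rewrite exprn_gt0.
have mFS := measurableT_comp mF (measurable_steps ks).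
have mg : measurable_fun setT g.
  rewrite /g; under eq_fun do rewrite big_mkcond/=.
  apply: measurable_sum => lm; case: (lm != _) => //.
  by apply: measurable_funM => //; exact: measurable_mx_entry.
rewrite (@ge0_integral_mset _ (fun X => F (foldr step X ks)) i i _ g c0)//; last first.
  move=> X z; apply: eq_bigr => -[l m] lm; rewrite mxE/=.
  by move: lm; rewrite xpair_eqE => /negbTE ->.
rewrite muleA -EFinM -exprD sks.
rewrite (_ : d.-1 + 2 = d.+1)%N; last by have := ltn_ord i; lia.
(* The steps write column [i] as the mirror of row [i]; this agrees with the congruence on symmetric
   matrices, which carry the measure. *)
congr (_ * _); apply: ge0_eq_integral_lebesgue_sym => //.
- apply: (measurableT_comp mFS); apply: measurable_mset => //.
  apply: measurable_funD => //; apply: measurable_funM => //.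
  exact: measurable_mx_entry.
- apply: (measurableT_comp mF).
  by apply: measurable_mulmx => //; exact: measurable_mulmx.
move=> X Xs; have sX a b : X a b = X b a by rewrite -[in LHS]Xs mxE.
congr F; apply/matrixP => a b.
have mulT (Y : 'M[R]_d) : (Y *m row_repl_mx^T) a b =
    if b == i then (\sum_l r l * Y a l)%R else Y a b.
  rewrite -[Y in LHS]trmxK -trmx_mul mxE row_repl_mul.
  case: ifP => _; last by rewrite mxE.
  by apply: eq_bigr => l _; rewrite mxE.
rewrite mulT (foldr_stepE _ uks iks) !ksE.
have [->|ai] := eqVneq a i; have [->|bi] := eqVneq b i => //=.
- rewrite mxE !eqxx/=; under [RHS]eq_bigr do rewrite row_repl_mul eqxx mulr_sumr.
  rewrite exchange_big pair_big/= (bigD1 (i, i))//= mulrA -expr2.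
  rewrite /g; congr (_ + _)%R.
  by apply: eq_bigr => lm _; rewrite mulrA [(r lm.2 * _)%R]mulrC.
- rewrite row_repl_mul eqxx; apply: eq_bigr => l _.
  by rewrite mxE (negbTE bi) !andbF.
- apply: eq_bigr => l _; rewrite row_repl_mul (negbTE ai).
  by rewrite mxE (negbTE ai) !andbF [X l a]sX.
- by rewrite row_repl_mul mxE (negbTE ai) (negbTE bi).
Qed.

End row_replacement.
End lebesgue_sym_congruence.

(** * Integration against the image of a measure with density *)

Section density_transfer.
Context d d' (S : measurableType d) (T : measurableType d') (R : realType).
Variables (sigma : {measure set S -> \bar R}) (mu : {measure set T -> \bar R}).
Variables (V : S -> T) (H : S -> R).
Hypotheses (mV : measurable_fun setT V) (mH : measurable_fun setT H).
Hypothesis H0 : forall x, 0 <= H x.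
Local Open Scope ereal_scope.
Hypothesis VH : forall A, measurable A ->
  \int[sigma]_(x in V @^-1` A) (H x)%:E = mu A.

Import HBNNSimple.

Let mVA A : measurable A -> measurable (V @^-1` A).
Proof. by move=> mA; rewrite -[X in measurable X]setTI; exact: mV. Qed.

Let density_transfer_nnsfun (h : {nnsfun T >-> R}) :
  \int[sigma]_x ((H x)%:E * (h (V x))%:E) = \int[mu]_y (h y)%:E.
Proof.
rewrite integralT_nnsfun sintegralE.
pose ind y x := (\1_(V @^-1` (h @^-1` [set y])) x : R).
have m1 y : measurable_fun setT (ind y).
  by apply: measurable_indic; exact: mVA.
have h0 y x : (0 <= y * ind y x)%R := nnfun_muleindic_ge0 h y (V x).
transitivity (\int[sigma]_x \sum_(y \in range h) (H x * (y * ind y x))%:E).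
  apply: eq_integral => x _; rewrite [in LHS]fimfunE.
  rewrite -EFinM fsbig_finite//= mulr_sumr -sumEFin fsbig_finite//=.
rewrite ge0_integral_fsum//; last 2 first.
- move=> y; apply/measurable_EFinP; apply: measurable_funM => //.
  exact: measurable_funM.
- by move=> y x _; rewrite lee_fin mulr_ge0.
apply: eq_fsbigr => y /[!inE] -[t _ hy].
under eq_integral do rewrite mulrCA EFinM.
rewrite ge0_integralZl//; last 3 first.
- by apply/measurable_EFinP; exact: measurable_funM.
- by move=> x _; rewrite lee_fin mulr_ge0.
- by rewrite lee_fin -hy.
rewrite -VH// [in RHS]integral_mkcond epatch_indic.
by congr (_ * _); apply: eq_integral => x _; rewrite EFinM.
Qed.

(** [VH] says that [mu] is the image under [V] of the measure with density [H]. The identity passes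
    from sets to simple functions by linearity, then to [phi] by monotone convergence. It serves
    with [V] a sample variable and with [V] the identity. *)
Lemma ge0_integral_density (phi : T -> \bar R) :
  measurable_fun setT phi -> (forall y, 0 <= phi y) ->
  \int[sigma]_x ((H x)%:E * phi (V x)) = \int[mu]_y phi y.
Proof.
move=> mphi phi0; pose h := nnsfun_approx measurableT mphi.
have cvgh y : EFin \o h ^~ y @ \oo --> phi y by apply: cvg_nnsfun_approx.
have ndh y : {homo (fun n => h n y) : m n / (m <= n)%N >-> (m <= n)%R}.
  by move=> m n mn; exact/lefP/nd_nnsfun_approx.
transitivity (limn (fun n => \int[mu]_y (h n y)%:E)); last first.
  rewrite -monotone_convergence//.
  - by apply: eq_integral => y _; apply/cvg_lim => //; exact: cvgh.
  - by move=> n; exact/measurable_EFinP.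
  - by move=> n y _; rewrite lee_fin.
  - by move=> y _ m n mn; rewrite lee_fin ndh.
transitivity (limn (fun n => \int[sigma]_x ((H x)%:E * (h n (V x))%:E))).
  rewrite -monotone_convergence//.
  - apply: eq_integral => x _; apply/esym/cvg_lim => //.
    by apply: cvgeZl => //; exact: cvgh.
  - move=> n; apply/measurable_EFinP; apply: measurable_funM => //.
    exact: measurableT_comp.
  - by move=> n x _; rewrite mule_ge0// lee_fin.
  - by move=> x _ m n mn; rewrite lee_wpmul2l// lee_fin// ndh.
by apply: congr_lim; apply/funext => n; exact: density_transfer_nnsfun.
Qed.

End density_transfer.

(** * Products over an independent sample; Chernoff's bound and Borel-Cantelli *)

Section iid_chernoff.
Context (R : realType) d d' (Omega : measurableType d) (T : measurableType d').
Variables (P : probability Omega R) (W : nat -> {RV P >-> T}).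
Hypothesis indepW : mutually_independent W.
Local Open Scope ereal_scope.

(** Independence concerns events only, so the factors are integrated one at a time while the
    remaining variables are kept as events. *)
Lemma mutually_independent_integral_prod (phi : T -> R) (e : R) :
  measurable_fun setT phi -> (forall y, 0 <= phi y)%R -> (0 <= e)%R ->
  (forall k, \int[P]_omega (phi (W k omega))%:E = e%:E) ->
  forall n, \int[P]_omega (\prod_(k < n) phi (W k omega))%:E = (e ^+ n)%:E.
Proof.
move=> mphi phi0 e0 phie n.
have mW k A : measurable A -> measurable (W k @^-1` A).
  by move=> mA; rewrite -[X in measurable X]setTI; exact: (measurable_funP (W k)).
have mphiW k : measurable_fun setT (fun omega => phi (W k omega)).
  exact: (measurableT_comp mphi (measurable_funP (W k))).
pose F m omega := (\prod_(k < m) phi (W k omega))%R.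
have mF m : measurable_fun setT (F m) by apply: measurable_prod => k _.
have F0 m omega : (0 <= F m omega)%R by apply: prodr_ge0 => k _.
pose D (J : {fset nat}) (A : nat -> set T) :=
  \bigcap_(i in [set` J]) W i @^-1` A i.
have mD J A : (forall i, measurable (A i)) -> measurable (D J A).
  move=> mA; apply: fin_bigcap_measurable; first exact: finite_fset.
  by move=> i _; exact: mW.
(* The event on indices at least [m] is what lets the induction use independence: it can absorb a
   condition on [W m]. *)
suff key m (J : {fset nat}) (A : nat -> set T) : (forall i, i \in J -> (m <= i)%N) ->
    (forall i, measurable (A i)) ->
    \int[P]_(omega in D J A) (F m omega)%:E = (e ^+ m)%:E * P (D J A).
  have := key n fset0 (fun=> setT).
  rewrite (_ : D _ _ = setT); last first.
    by apply/seteqP; split=> // omega _ i; rewrite /= inE.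
  by rewrite probability_setT mule1; apply => // i; rewrite inE.
elim: m J A => [|m IH] J A Jm mA.
  rewrite expr0 mul1e; under eq_integral do rewrite /F big_ord0.
  by rewrite integral_cst ?mul1e//; exact: mD.
rewrite integral_mkcond.
pose H omega := (F m omega * \1_(D J A) omega)%R.
have mH : measurable_fun setT H.
  by apply: measurable_funM => //; apply: measurable_indic; exact: mD.
have H0 omega : (0 <= H omega)%R by rewrite mulr_ge0.
have c0 : (0 <= e ^+ m * fine (P (D J A)))%R.
  by rewrite mulr_ge0 ?exprn_ge0// fine_ge0.
have PDfin : P (D J A) \is a fin_num by exact: fin_num_measure (mD J A mA).
(* With the condition that [W m] lies in [B] added to the event, the induction hypothesis shows that
   [W m] carries the weight [H] to a constant multiple of its own law. *)
have VH B : measurable B -> \int[P]_(omega in W m @^-1` B) (H omega)%:E =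
    mscale (NngNum c0) (distribution P (W m)) B.
  move=> mB; pose A' i := if i == m then B else A i.
  have mA' i : measurable (A' i) by rewrite /A'; case: ifP.
  have mJ : m \notin J by apply/negP => /Jm; rewrite ltnn.
  have A'E i : i \in J -> A' i = A i.
    by rewrite /A'; case: eqP => // -> /Jm; rewrite ltnn.
  have DE : D (m |` J)%fset A' = W m @^-1` B `&` D J A.
    apply/seteqP; split=> omega /=.
      move=> h; split; first by have := h m; rewrite /A' eqxx /=; apply; rewrite fset1U1.
      by move=> i /= iJ; have := h i; rewrite /= A'E//; apply; rewrite in_fset1U iJ orbT.
    move=> [hm h] i /=; rewrite in_fset1U => /orP[/eqP->|iJ].
      by rewrite /A' eqxx.
    by rewrite A'E//; exact: h.
  transitivity (\int[P]_(omega in D (m |` J)%fset A') (F m omega)%:E).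
    rewrite DE integral_mkcondr; apply: eq_integral => omega _.
    by rewrite epatch_indic /H EFinM.
  rewrite IH//; last first.
    by move=> i; rewrite in_fset1U => /orP[/eqP->//|/Jm/ltnW].
  rewrite indepW// big_fsetU1//= /mscale/= /distribution/= /pushforward.
  rewrite EFinM fineK// -muleA [X in _ = _ * X]muleC [P (D J A)]indepW//.
  rewrite {1}/A' eqxx; congr (_ * (_ * _)); apply: eq_big_seq => i iJ.
  by rewrite A'E.
have mE : measurable_fun setT (EFin \o phi) by exact/measurable_EFinP.
have E0 y : 0 <= (EFin \o phi) y by rewrite lee_fin.
transitivity (\int[P]_omega ((H omega)%:E * (EFin \o phi) (W m omega))).
  apply: eq_integral => omega _.
  by rewrite epatch_indic /F big_ord_recr/= -!EFinM mulrAC.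
rewrite (ge0_integral_density (measurable_funP (W m)) mH H0 VH mE E0).
rewrite ge0_integral_mscale// ge0_integral_distribution// phie/= EFinM fineK//.
by rewrite exprSr EFinM -!muleA [X in _ * X]muleC.
Qed.

Local Close Scope ereal_scope.

(* Chernoff's bound: the probability that the average of h over the first n terms
   is below c - eps is at most expR (- n eps). *)
Lemma chernoff_ge (h : T -> R) (c : R) : measurable_fun setT h ->
  (forall k, \int[P]_omega (expR (- h (W k omega)))%:E = (expR (- c))%:E)%E ->
  forall eps, 0 < eps ->
  {ae P, forall omega, \forall n \near \oo,
     n%:R * (c - eps) <= \sum_(k < n) h (W k omega)}.
Proof.
move=> mh hc eps eps0.
have mhW k : measurable_fun setT (fun omega => h (W k omega)).
  exact: (measurableT_comp mh (measurable_funP (W k))).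
have msum n : measurable_fun setT (fun omega => \sum_(k < n) h (W k omega)).
  exact: measurable_sum.
pose E n := [set omega | \sum_(k < n) h (W k omega) < n%:R * (c - eps)].
have mE n : measurable (E n).
  have := msum n measurableT `]-oo, n%:R * (c - eps)[%classic (measurable_itv _).
  by rewrite setTI preimage_itvNyo.
pose phi y := expR (- h y).
have mphi : measurable_fun setT phi.
  by apply: (measurableT_comp (@measurable_expR R)); exact: measurable_funN.
pose q := expR (- eps).
have PE n : (P (E n) <= (q ^+ n)%:E)%E.
  have prodE omega : \prod_(k < n) phi (W k omega) = expR (- \sum_(k < n) h (W k omega)).
    by rewrite -sumrN expR_sum.
  have mprod : measurable_fun setT (fun omega => \prod_(k < n) phi (W k omega)).
    apply: measurable_prod => k _.
    exact: (measurableT_comp mphi (measurable_funP (W k))).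
  have a0 : 0 < expR (- (n%:R * (c - eps))) by exact: expR_gt0.
  (* Markov's inequality: on [E n] the product of the [phi (W k omega)] is at least
     [expR (- (n%:R * (c - eps)))], and by independence its expectation is [expR (- c) ^+ n]. *)
  suff : ((expR (- (n%:R * (c - eps))))%:E * P (E n) <= (expR (- c) ^+ n)%:E)%E.
    rewrite -lee_pdivlMl// => /le_trans; apply.
    rewrite -EFinM lee_fin /q -!expRM_natl -expRN -expRD.
    by rewrite le_eqVlt; apply/orP; left; apply/eqP; congr expR; ring.
  rewrite -(mutually_independent_integral_prod mphi (fun y => expR_ge0 _)
    (expR_ge0 _) hc).
  rewrite -integral_cst//.
  apply: (@le_trans _ _ (\int[P]_(omega in E n)
      (\prod_(k < n) phi (W k omega))%:E)%E).
    apply: ge0_le_integral => //.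
    - by move=> omega _; rewrite lee_fin expR_ge0.
    - by apply/measurable_EFinP; exact: measurable_funTS.
    - by move=> omega /= h1; rewrite lee_fin prodE ler_expR lerN2 ltW.
  apply: ge0_subset_integral => //.
    exact/measurable_EFinP.
  by move=> omega _; rewrite lee_fin prodr_ge0// => k _; exact: expR_ge0.
have q1 : q < 1 by rewrite /q expR_lt1 oppr_lt0.
(* The bounds [q ^+ n] form a convergent geometric series, so Borel-Cantelli makes the upper limit
   of the [E n] negligible. *)
have : (\sum_(n <oo) P (E n) < +oo)%E.
  apply: (@le_lt_trans _ _ ((1 - q)^-1)%:E); last exact: ltry.
  apply: lime_le; first by apply: is_cvg_nneseries => n _ _.
  apply: nearW => n.
  apply: (@le_trans _ _ (\sum_(0 <= i < n) (q ^+ i)%:E)%E).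
    by apply: lee_sum => i _; exact: PE.
  rewrite sumEFin lee_fin -[leRHS]mul1r.
  apply: le_trans (geometric_le_lim n ler01 (expR_gt0 _) _); last first.
    by rewrite ger0_norm ?expR_ge0.
  by rewrite /series/=; apply: ler_sum => i _; rewrite mul1r.
move=> /(lim_sup_set_cvg0 mE) PE0.
exists (lim_sup_set E); split=> //.
  apply: bigcap_measurable => // n _; exact: bigcup_measurable.
move=> omega /= nE N _; apply: contrapT => nL; apply: nE.
exists N => // n /= Nn; rewrite leNgt; apply/negP => En.
by apply: nL; exists n.
Qed.

End iid_chernoff.

(** * Congruences with known Jacobian *)

Section sym_jacobian.
Context (R : realType) (d : nat).
Local Open Scope ereal_scope.

(** A property of [A], established for row replacements with positive pivot and stable under
    products. The determinant carries no absolute value: it is positive for the matrices to which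
    this is applied. *)
Definition sym_jacobian (A : 'M[R]_d) := forall F : 'M[R]_d -> \bar R,
  measurable_fun setT F -> (forall X, 0 <= F X) ->
  \int[@lebesgue_sym R d]_X F X =
  (\det A ^+ d.+1)%:E * \int[@lebesgue_sym R d]_X F (A *m X *m A^T).

Lemma measurable_congr (A : 'M[R]_d) :
  measurable_fun setT (fun X : 'M[R]_d => A *m X *m A^T).
Proof. by apply: measurable_mulmx => //; exact: measurable_mulmx. Qed.

Lemma sym_jacobian_mul (A B : 'M[R]_d) :
  sym_jacobian A -> sym_jacobian B -> sym_jacobian (A *m B).
Proof.
move=> jA jB F mF F0; rewrite jA// jB//; last first.
  exact: (measurableT_comp mF (measurable_congr A)).
rewrite muleA -EFinM -exprMn det_mulmx; congr (_ * _).
by apply: eq_integral => X _; rewrite trmx_mul !mulmxA.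
Qed.

(** The diagonal entries are scaled one after the other; [D n] has the first [n] of them scaled. *)
Lemma sym_jacobian_scalar (c : R) : (0 < c)%R -> sym_jacobian c%:M.
Proof.
move=> c0; pose D n : 'M[R]_d := diag_mx (\row_l if (l < n)%N then c else 1%R).
have DE : c%:M = D d.
  rewrite -diag_const_mx; congr diag_mx; apply/rowP => l.
  by rewrite !mxE ltn_ord.
suff DJ n : (n <= d)%N -> sym_jacobian (D n) by rewrite DE; exact: DJ.
elim: n => [_|n IH nd].
  rewrite (_ : D 0%N = 1%:M).
    move=> F mF F0; rewrite det1 expr1n mul1e; apply: eq_integral => X _.
    by rewrite trmx1 mulmx1 mul1mx.
  by rewrite -diag_const_mx; congr diag_mx; apply/rowP => l; rewrite !mxE.
pose i := Ordinal nd.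
pose r (l : 'I_d) : R := if l == i then c else 0%R.
rewrite (_ : D n.+1 = row_repl_mx i r *m D n).
  apply: sym_jacobian_mul; last exact/IH/ltnW.
  by move=> F mF F0; apply: ge0_integral_row_repl => //; rewrite /r eqxx.
apply/matrixP => a b; rewrite row_repl_mul /r; case: eqVneq => [->|ai].
  rewrite (bigD1 i)//= eqxx big1 ?addr0 => [|l /negbTE->]; last by rewrite mul0r.
  rewrite !mxE ltnS leqnn ltnn; case: eqVneq => _; rewrite ?mulr1n ?mulr1//.
  by rewrite !mulr0n mulr0.
by rewrite !mxE ltnS leq_eqVlt -(inj_eq val_inj) /= in ai *; rewrite (negbTE ai).
Qed.

End sym_jacobian.

(** * Exponential moments of the Wishart law *)

Section wishart_laplace.
Context (R : realType) (d : nat) (alpha : R) (Sigma : 'M[R]_d).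

(** The function h_A: the amount by which the congruence raises half the trace in the exponent of
    the density. *)
Definition congr_incr (A X : 'M[R]_d) : R :=
  (\tr (invmx Sigma *m (A *m X *m A^T)) - \tr (invmx Sigma *m X)) / 2.

Lemma measurable_congr_incr A : measurable_fun setT (congr_incr A).
Proof.
apply: measurable_funM => //; apply: measurable_funB.
  apply: measurable_mxtrace; apply: measurable_mulmx => //; exact: measurable_congr.
by apply: measurable_mxtrace; apply: measurable_mulmx.
Qed.

Lemma wishart_density_ge0 X : 0 <= wishart_density alpha Sigma X.
Proof.
rewrite /wishart_density !mulr_ge0 ?powR_ge0 ?expR_ge0// invr_ge0.
rewrite mulr_ge0 ?powR_ge0// /multivariate_gamma.
by apply: Rintegral_ge0 => Y _; rewrite mulr_ge0 ?powR_ge0 ?expR_ge0.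
Qed.

Lemma measurable_wishart_density :
  measurable_fun setT (@wishart_density R d alpha Sigma).
Proof.
apply: measurable_funM => //; apply: measurable_funM.
  by apply: (measurableT_comp (@measurable_powR R _)); exact: measurable_det.
apply: (measurableT_comp (@measurable_expR R)); apply: measurable_funM => //.
by apply: measurable_funN; apply: measurable_mxtrace; exact: measurable_mulmx.
Qed.

Lemma wishart_density_congr (A X : 'M[R]_d) : 0 < \det A -> posdefmx X ->
  wishart_density alpha Sigma (A *m X *m A^T) =
  \det A `^ (alpha - d.+1%:R) * (expR (- congr_incr A X) *
    wishart_density alpha Sigma X).
Proof.
move=> A0 Xp; rewrite /wishart_density.
have X0 := posdefmx_det_gt0 Xp.
rewrite !det_mulmx det_tr [_ * \det X]mulrC -mulrA powRM ?mulr_ge0 ?ltW//.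
rewrite powRM ?ltW//.
set a := (alpha / 2 - _).
(* The determinant of [A] enters twice, from [A] and from [A^T], which doubles the exponent [a]. *)
rewrite (_ : alpha - d.+1%:R = a + a); last by rewrite /a; lra.
rewrite [_ `^ (a + a)]powRD; last by apply/implyP => _; rewrite gt_eqF.
rewrite (_ : expR (- \tr (invmx Sigma *m (A *m X *m A^T)) / 2) =
  expR (- congr_incr A X) * expR (- \tr (invmx Sigma *m X) / 2)); last first.
  by rewrite -expRD; congr expR; rewrite /congr_incr; lra.
ring.
Qed.

Context dO (Omega : measurableType dO) (P : probability Omega R).
Variable W : {RV P >-> 'M[R]_d}.
Hypothesis lawW : forall A : set 'M[R]_d, measurable A ->
  distribution P W A = wishart alpha Sigma A.

Lemma wishart_posdefmx : {ae P, forall omega, posdefmx (W omega)}.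
Proof.
have mN : measurable (~` @posdefmx R d).
  exact: measurableC (@measurable_posdefmx R d).
exists (W @^-1` (~` @posdefmx R d)); split => //.
- by rewrite -[X in measurable X]setTI; exact: (measurable_funP W).
- have := lawW mN; rewrite /distribution/= /pushforward => ->.
  by rewrite /wishart setICl integral_set0.
Qed.

(* The Wishart density f satisfies f (A X A^T) = |A|^(alpha - d - 1)
   expR (- congr_incr A X) f X and integrates to one, so that this follows from the
   change of variables X -> A X A^T, whose Jacobian is |A|^(d + 1). *)
Lemma wishart_laplace (A : 'M[R]_d) : sym_jacobian A -> 0 < \det A ->
  (\int[P]_omega (expR (- congr_incr A (W omega)))%:E =
   (expR (- (alpha * ln (\det A))))%:E)%E.
Proof.
move=> jA A0.
pose f X := wishart_density alpha Sigma X * \1_(@posdefmx R d) X.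
have mf : measurable_fun setT f.
  apply: measurable_funM; first exact: measurable_wishart_density.
  by apply: measurable_indic; exact: measurable_posdefmx.
have f0 X : 0 <= f X by rewrite mulr_ge0// wishart_density_ge0.
have mfE : measurable_fun setT (EFin \o f) by exact/measurable_EFinP.
have f0E X : (0 <= (EFin \o f) X)%E by rewrite lee_fin.
have fE B : measurable B -> (\int[@lebesgue_sym R d]_(X in id @^-1` B) (f X)%:E =
    distribution P W B)%E.
  move=> mB; rewrite lawW// /wishart integral_mkcondr; apply: eq_integral => X _.
  by rewrite epatch_indic /f EFinM.
pose e := fun X => expR (- congr_incr A X).
have me : measurable_fun setT (EFin \o e).
  apply/measurable_EFinP; apply: (measurableT_comp (@measurable_expR R)).
  by apply: measurable_funN; exact: measurable_congr_incr.
have e0 X : (0 <= (EFin \o e) X)%E by rewrite lee_fin expR_ge0.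
(* Outside the cone both sides vanish, since the congruence preserves the cone and its
   complement. *)
have fA X : f (A *m X *m A^T) = \det A `^ (alpha - d.+1%:R) * (f X * e X).
  have Au : A \in unitmx by rewrite unitmxE unitfE gt_eqF.
  rewrite /f !indicE; have [Xp|Xp] := pselect (posdefmx X).
    rewrite !mem_set//; last exact/posdefmx_congr.
    by rewrite !mulr1 wishart_density_congr// /e [X in _ * X = _]mulrC.
  rewrite !memNset//; last by move=> /(posdefmx_congr _ Au).
  by rewrite !mulr0 mul0r mulr0.
(* Total mass one is read off from the law on [setT], as [P] is a probability. *)
have int_f : (\int[@lebesgue_sym R d]_X (f X)%:E = 1)%E.
  have := fE setT measurableT; rewrite preimage_setT => ->.
  exact: probability_setT.
have int_fe : (\int[@lebesgue_sym R d]_X ((f X)%:E * (EFin \o e) X) =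
    \int[P]_omega (e (W omega))%:E)%E.
  rewrite (ge0_integral_density (@measurable_id _ _ setT) mf f0 fE me e0).
  by rewrite ge0_integral_distribution.
(* Substituting in the total mass of [f]: the density contributes the power [alpha - d.+1%:R] of the
   determinant and the Jacobian [d.+1], in all [alpha]. *)
have := jA _ mfE f0E; rewrite int_f.
under eq_integral do rewrite /= fA EFinM EFinM.
rewrite ge0_integralZl//; last 3 first.
- by apply: emeasurable_funM => //; exact/measurable_EFinP.
- by move=> X _; rewrite -EFinM lee_fin mulr_ge0// expR_ge0.
- by rewrite lee_fin powR_ge0.
rewrite int_fe muleA -EFinM -powR_mulrn ?ltW// -powRD; last
  by apply/implyP => _; rewrite gt_eqF.
rewrite addrC subrK => H.
have a0 : 0 < \det A `^ alpha by rewrite powR_gt0.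
transitivity ((\det A `^ alpha)^-1%:E * 1%E)%E.
  by rewrite H muleA -EFinM mulVf ?gt_eqF// mul1e.
by rewrite mule1 expRN /powR gt_eqF.
Qed.

End wishart_laplace.

(** * Transvections, and the law of large numbers along a fixed sample path *)

Section transvections.
Context (R : realType) (d : nat).

Lemma mxtrace_mul_delta (M : 'M[R]_d) i j : \tr (M *m delta_mx j i) = M i j.
Proof.
rewrite /mxtrace (bigD1 i)//= [X in _ + X]big1 ?addr0 => [|k /negbTE ki].
  rewrite mxE (bigD1 j)//= mxE !eqxx mulr1 big1 ?addr0// => k /negbTE kj.
  by rewrite mxE kj mulr0.
by rewrite mxE big1// => l _; rewrite mxE ki andbF mulr0.
Qed.

Lemma mxtrace_delta_congr (K X : 'M[R]_d) i j :
  \tr (K *m delta_mx i j *m X *m delta_mx j i) = K i i * X j j.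
Proof.
rewrite mxtrace_mul_delta mxE (bigD1 j)//= big1 ?addr0 => [|k kj].
  rewrite mxE (bigD1 i)//= mxE !eqxx mulr1 big1 ?addr0// => l /negbTE li.
  by rewrite mxE li mulr0.
by rewrite mxE big1 ?mul0r// => l _; rewrite mxE (negbTE kj) andbF mulr0.
Qed.

(** The matrix I + t E_ij, written as a row replacement to inherit its Jacobian; for [i = j] it is a
    scaling of determinant [1 + t]. *)
Definition transvection (i j : 'I_d) (t : R) : 'M[R]_d :=
  row_repl_mx i (fun l => (i == l)%:R + t * (l == j)%:R).

Lemma det_transvection i j t : \det (transvection i j t) = 1 + t * (i == j)%:R.
Proof. by rewrite det_row_repl eqxx. Qed.

Lemma transvectionE i j t : transvection i j t = 1%:M + t *: delta_mx i j.
Proof.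
apply/matrixP => a b; rewrite !mxE.
by case: eqVneq => [->|ai]; rewrite ?andTb// mulr0 addr0.
Qed.

Lemma sym_jacobian_transvection i j t :
  0 < \det (transvection i j t) -> sym_jacobian (transvection i j t).
Proof.
rewrite {1}/transvection det_row_repl => r0 F mF F0.
exact: ge0_integral_row_repl.
Qed.

Variables (alpha : R) (Sigma : 'M[R]_d).
Hypotheses (alpha0 : 0 < alpha) (Sp : posdefmx Sigma).
Local Notation K := (invmx Sigma).

Let Su : Sigma \in unitmx.
Proof. by rewrite unitmxE unitfE gt_eqF// posdefmx_det_gt0. Qed.

(** By symmetry of [X] and [Sigma] the two first-order traces coincide, which cancels the factor 1/2
    in [congr_incr]. *)
Lemma congr_incr_transvection i j t (X : 'M[R]_d) : X^T = X ->
  congr_incr Sigma (transvection i j t) X =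
  t * (K *m X) i j + t ^+ 2 * (K i i * X j j / 2).
Proof.
move=> Xs; rewrite /congr_incr transvectionE.
rewrite linearD/= linearZ/= trmx1 trmx_delta.
rewrite !(mulmxDl, mulmxDr, mul1mx, mulmx1) -!(scalemxAl, scalemxAr) !mulmxA.
rewrite !mxtraceD !mxtraceZ mxtrace_delta_congr mxtrace_mul_delta.
have -> : \tr (K *m delta_mx i j *m X) = (K *m X) i j.
  rewrite -mulmxA mxtrace_mulC -mulmxA mxtrace_mulC mxtrace_mul_delta.
  have -> : X *m K = (K *m X)^T by rewrite trmx_mul Xs trmx_inv Sp.1.
  by rewrite mxE.
lra.
Qed.

(** The bound [ln (1 + x) <= x] at [x = - (u / (1 + u))] gives [ln (1 + u) >= u / (1 + u)]; the rest
    is nonnegative because [u >= - 2^-1]. *)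
Lemma ln1D_ge (u : R) : `|u| <= 2^-1 -> u - 2 * u ^+ 2 <= ln (1 + u).
Proof.
rewrite ler_norml => /andP[u1 u2]; have u0 : 0 < 1 + u by lra.
have u0' : 1 + u != 0 by rewrite gt_eqF.
have E : 1 - u / (1 + u) = (1 + u)^-1 by field.
rewrite -[X in ln X]invrK -E.
have h : u / (1 + u) < 1 by rewrite ltr_pdivrMr//; lra.
rewrite lnV ?posrE ?subr_gt0// lerNr.
have : - 1 < - (u / (1 + u)) by lra.
move=> /le_ln1Dx/le_trans; apply; rewrite -subr_ge0.
have -> : - (u - 2 * u ^+ 2) - - (u / (1 + u)) = u ^+ 2 * (1 + 2 * u) / (1 + u) by field.
apply: divr_ge0; last lra.
by apply: mulr_ge0; [exact: sqr_ge0|lra].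
Qed.

(* The lower bounds for t and - t, where the terms t ^+ 2 * b are negligible, give
   both inequalities for a. *)
Lemma wishart_slln_sample (X : nat -> 'M[R]_d) (C1 : R) :
  (forall k, posdefmx (X k)) ->
  (\forall n \near \oo, \sum_(k < n) \tr (K *m X k) <= n%:R * C1) ->
  (forall i j m (b : bool), let t := (-1) ^+ b / m.+2%:R in
    \forall n \near \oo, n%:R * (alpha * ln (\det (transvection i j t)) - t ^+ 2) <=
      \sum_(k < n) congr_incr Sigma (transvection i j t) (X k)) ->
  forall i j, n%:R^-1 * \sum_(k < n) (K *m X k) i j @[n --> \oo] -->
    alpha * (i == j)%:R.
Proof.
move=> Xp trX cX i j.
have [Kc Kc0 XK] := posdefmx_entry_le_tr Sp.
(* [C2] bounds the averages of the second-order terms. In [C3], [2 * alpha] is the loss in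
   [ln1D_ge], [1] the slack and [C2] the second-order terms, each taken relative to [t ^+ 2]. *)
pose C2 := `|K i i| / 2 * (Kc * C1).
pose C3 := 2 * alpha + 1 + C2.
have C20 : \forall n \near \oo, `|\sum_(k < n) (K i i * X k j j / 2)| <= n%:R * C2.
  near=> n.
  apply: (le_trans (ler_norm_sum _ _ _)).
  apply: (@le_trans _ _ (\sum_(k < n) (`|K i i| / 2 * (Kc * \tr (K *m X k))))).
    apply: ler_sum => k _; rewrite !normrM [X in _ * X]ger0_norm// mulrAC.
    by rewrite ler_wpM2l ?XK// mulr_ge0.
  rewrite -!mulr_sumr /C2 [leRHS]mulrCA ler_wpM2l ?mulr_ge0//.
  rewrite [leRHS]mulrCA ler_wpM2l//.
  by near: n.
apply/cvgrPdist_le => eps eps0.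
(* This makes [tau * C3] at most [eps]; the offset 2 in [m.+2] ensures [tau <= 2^-1], the range of
   [ln1D_ge]. *)
pose m := Num.truncn (`|C3| / eps).
pose tau : R := m.+2%:R^-1.
have tau0 : 0 < tau by rewrite invr_gt0.
have tauC : tau * C3 <= eps.
  rewrite /tau mulrC ler_pdivrMr// mulrC -ler_pdivrMr//.
  apply: (@le_trans _ _ (`|C3| / eps)); first by rewrite ler_pM2r ?invr_gt0// ler_norm.
  by apply: ltW; apply: (lt_trans (truncnS_gt _)); rewrite ltr_nat.
have step (b : bool) : \forall n \near \oo,
    - (n%:R * (tau * C3)) <= (-1) ^+ b *
      (\sum_(k < n) (K *m X k) i j - n%:R * (alpha * (i == j)%:R)).
  near=> n.
  pose t : R := (-1) ^+ b / m.+2%:R.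
  have t2 : t ^+ 2 = tau ^+ 2 by rewrite exprMn sqrr_sign mul1r.
  have tau2 : tau <= 2^-1 by rewrite /tau lef_pV2 ?posrE// ler_nat.
  have lnt : t * (i == j)%:R - 2 * t ^+ 2 <= ln (\det (transvection i j t)).
    rewrite det_transvection; apply: (le_trans _ (ln1D_ge _)).
      case: (i == j); rewrite ?mulr1// mulr0 expr0n/= mulr0 subr0 sub0r oppr_le0.
      by rewrite mulr_ge0// sqr_ge0.
    rewrite normrM normrM normr_sign mul1r ger0_norm ?invr_ge0// normr_nat.
    by case: (i == j); rewrite ?mulr1// mulr0 invr_ge0.
  have : n%:R * (alpha * ln (\det (transvection i j t)) - t ^+ 2) <=
      \sum_(k < n) congr_incr Sigma (transvection i j t) (X k).
    by near: n; exact: cX.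
  under [leRHS]eq_bigr do rewrite congr_incr_transvection ?(Xp _).1//.
  rewrite big_split/= -!mulr_sumr.
  have : `|\sum_(k < n) (K i i * X k j j / 2)| <= n%:R * C2 by near: n.
  rewrite ler_norml => /andP[_].
  set A := \sum_(k < n) (K *m X k) i j; set D := \sum_(k < n) _ => hD hA.
  have n0 : (0 : R) <= n%:R by [].
  set s : R := (-1) ^+ b.
  have tE : t = s * tau by [].
  rewrite -(ler_pM2l tau0).
  have hln : n%:R * (alpha * (t * (i == j)%:R - 2 * t ^+ 2) - t ^+ 2) <=
      t * A + t ^+ 2 * D.
    apply: le_trans hA; rewrite ler_wpM2l// lerB// ler_wpM2l// ltW//.
  have hD2 : t ^+ 2 * D <= t ^+ 2 * (n%:R * C2) by rewrite ler_wpM2l// sqr_ge0.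
  rewrite t2 in hln hD2; rewrite tE in hln.
  rewrite /C3; nra.
have [stepP stepN] := (step false, step true).
near=> n.
have n0 : (0 : R) < n%:R by rewrite ltr0n; near: n; exact: nbhs_infty_gt.
have hP : - (n%:R * (tau * C3)) <= (-1) ^+ false *
  (\sum_(k < n) (K *m X k) i j - n%:R * (alpha * (i == j)%:R)) by near: n.
have hN : - (n%:R * (tau * C3)) <= (-1) ^+ true *
  (\sum_(k < n) (K *m X k) i j - n%:R * (alpha * (i == j)%:R)) by near: n.
move: hP hN; rewrite expr0 expr1 mul1r mulN1r => hP hN.
rewrite distrC; apply: le_trans tauC.
set A := \sum_(k < n) (K *m X k) i j in hP hN *.
have -> : n%:R^-1 * A - alpha * (i == j)%:R =
    (A - n%:R * (alpha * (i == j)%:R)) / n%:R.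
  by field; rewrite gt_eqF.
rewrite normrM [X in _ * X]ger0_norm ?invr_ge0// ler_pdivrMr// ler_norml.
by rewrite [tau * C3 * _]mulrC hP/=; lra.
Unshelve. all: by end_near. Qed.

End transvections.

(** * Countable almost sure statements and entrywise limits *)

Lemma ae_forall_countable d (T : measurableType d) (R : realType)
    (mu : {measure set T -> \bar R}) (I : countType) (Q : I -> T -> Prop) :
  (forall i, {ae mu, forall x, Q i x}) -> {ae mu, forall x, forall i, Q i x}.
Proof.
move=> Qi; pose Q' n x := if choice.unpickle n is Some i then Q i x else True.
have : {ae mu, forall x, forall n, Q' n x}.
  apply: ae_foralln => n; rewrite /Q'; case: (choice.unpickle n) => [i|]; first exact: Qi.
  exact: aeW.
by apply: filterS => x Qx i; have := Qx (choice.pickle i); rewrite /Q' choice.pickleK.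
Qed.

Section matrix_limits.
Context (R : realType).

Lemma cvg_mx_entries m n (f : nat -> 'M[R]_(m, n)) (L : 'M[R]_(m, n)) :
  (forall i j, f t i j @[t --> \oo] --> L i j) -> f @ \oo --> L.
Proof.
move=> fL A [Q nQ QA]; rewrite /nbhs/=.
have : \forall t \near \oo, forall i j, Q i j (f t i j).
  by apply: filter_forall => i; apply: filter_forall => j; exact/fL/nQ.
by apply: filterS => t Qt; exact: QA.
Qed.

Lemma cvg_sum_mull (I : finType) (c : I -> R) (f : I -> nat -> R) (l : I -> R) :
  (forall i, f i n @[n --> \oo] --> l i) ->
  \sum_i c i * f i n @[n --> \oo] --> \sum_i c i * l i.
Proof.
move=> fl; apply: cvg_big => [|i _]; last exact: cvgMl_tmp.
by move=> x; exact: add_continuous.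
Qed.

End matrix_limits.

(** * The strong law of large numbers for Wishart samples *)

Section wishart_slln.
Context (R : realType) (d : nat) (alpha : R) (Sigma : 'M[R]_d).
Context dO (Omega : measurableType dO) (P : probability Omega R).
Variable W : nat -> {RV P >-> 'M[R]_d}.
Hypotheses (alpha0 : 0 < alpha) (Sp : posdefmx Sigma).
Hypothesis indepW : mutually_independent W.
Hypothesis lawW : forall k (A : set 'M[R]_d), measurable A ->
  distribution P (W k) A = wishart alpha Sigma A.

Let chernoff A (eps : R) : sym_jacobian A -> 0 < \det A -> 0 < eps ->
  {ae P, forall omega, \forall n \near \oo,
    n%:R * (alpha * ln (\det A) - eps) <=
    \sum_(k < n) congr_incr Sigma A (W k omega)}.
Proof.
move=> jA A0; apply: chernoff_ge => //; first exact: measurable_congr_incr.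
by move=> k; exact: (wishart_laplace (lawW k)).
Qed.

Lemma wishart_slln :
  {ae P, forall omega, forall i j,
    n%:R^-1 * \sum_(k < n) W k omega i j @[n --> \oo] --> alpha * Sigma i j}.
Proof.
have aeX : {ae P, forall omega, forall k, posdefmx (W k omega)}.
  by apply: ae_foralln => k; exact: (wishart_posdefmx (lawW k)).
pose c : R := 2^-1.
have ae_tr : {ae P, forall omega, \forall n \near \oo,
    n%:R * (alpha * ln (\det (c%:M : 'M[R]_d)) - 1) <=
    \sum_(k < n) congr_incr Sigma c%:M (W k omega)}.
  apply: chernoff => //; first by apply: sym_jacobian_scalar; rewrite invr_gt0.
  by rewrite det_scalar exprn_gt0// invr_gt0.
pose t m (b : bool) : R := (-1) ^+ b / m.+2%:R.
(* The parameters range over a countable set, so one null set serves all of them. The slack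
   [t m b ^+ 2] has the order of the other error terms. *)
have ae_tv : {ae P, forall omega, forall (x : 'I_d * 'I_d * nat * bool),
    let: (i, j, m, b) := x in
    \forall n \near \oo,
    n%:R * (alpha * ln (\det (transvection i j (t m b))) - t m b ^+ 2) <=
    \sum_(k < n) congr_incr Sigma (transvection i j (t m b)) (W k omega)}.
  apply: ae_forall_countable => -[[[i j] m] b].
  have det0 : 0 < \det (transvection i j (t m b)).
    rewrite det_transvection; case: (i == j); rewrite ?(mulr0, addr0)// mulr1.
    rewrite /t; case: b => /=.
      by rewrite expr1 mulN1r subr_gt0 invf_lt1// ltr1n.
    by rewrite expr0 mul1r ltr_pwDl// invr_ge0.
  apply: chernoff => //; first exact: sym_jacobian_transvection.
  by rewrite exprMn sqrr_sign mul1r exprn_gt0// invr_gt0.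
apply: filterS3 aeX ae_tr ae_tv => omega Xp trX tvX.
(* For [c = 1/2] the increment is [(c ^+ 2 - 1) / 2], that is -3/8, times the trace, so the lower
   bound with slack 1 becomes an upper bound on traces, with factor -8/3. *)
have KX := @wishart_slln_sample R d alpha Sigma alpha0 Sp (fun k => W k omega)
  (- (8 / 3) * (alpha * ln (\det (c%:M : 'M[R]_d)) - 1)) Xp.
have {}KX i j : n%:R^-1 * \sum_(k < n) (invmx Sigma *m W k omega) i j
    @[n --> \oo] --> alpha * (i == j)%:R.
  apply: KX => [|i' j' m b]; last exact: (tvX (i', j', m, b)).
  apply: filterS trX => n.
  have -> : \sum_(k < n) congr_incr Sigma c%:M (W k omega) =
      - (3 / 8) * \sum_(k < n) \tr (invmx Sigma *m W k omega).
    rewrite mulr_sumr; apply: eq_bigr => k _.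
    rewrite /congr_incr tr_scalar_mx mul_mx_scalar mul_scalar_mx scalerA.
    by rewrite -scalemxAr mxtraceZ /c; lra.
  by lra.
have Su : Sigma \in unitmx by rewrite unitmxE unitfE gt_eqF// posdefmx_det_gt0.
move=> i j.
(* [W k] is recovered as [Sigma] times [invmx Sigma *m W k], so the limit is [Sigma] times [alpha]
   times the identity. *)
have -> : alpha * Sigma i j = \sum_l Sigma i l * (alpha * (l == j)%:R).
  rewrite (bigD1 j)//= eqxx mulr1 big1 ?addr0 => [|l /negbTE->]; first exact: mulrC.
  by rewrite !mulr0.
rewrite (_ : (fun n => _) = (fun n => \sum_l Sigma i l *
    (n%:R^-1 * \sum_(k < n) (invmx Sigma *m W k omega) l j))).
  by apply: cvg_sum_mull => l; exact: KX.
apply/funext => n; under [RHS]eq_bigr do rewrite mulrCA mulr_sumr.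
rewrite -mulr_sumr exchange_big/=; congr (_ * _); apply: eq_bigr => k _.
by rewrite -[in LHS](mulKVmx Su (W k omega)) mxE.
Qed.

End wishart_slln.

(** * Least squares and the normal equations *)

Section least_squares.
Context (R : realType) (M p : nat).

Lemma norm2_sqr m (v : 'cV[R]_m) : norm2 v ^+ 2 = (v^T *m v) 0 0.
Proof.
rewrite sqr_sqrtr; last by apply: sumr_ge0 => i _; exact: sqr_ge0.
by rewrite mxE; apply: eq_bigr => i _; rewrite mxE expr2.
Qed.

Lemma norm2_sqrD_orthogonal m (u v : 'cV[R]_m) : u^T *m v = 0 ->
  norm2 (u + v) ^+ 2 = norm2 u ^+ 2 + norm2 v ^+ 2.
Proof.
move=> uv; have vu : v^T *m u = 0 by rewrite -[RHS]trmx0 -uv trmx_mul trmxK.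
rewrite !norm2_sqr [(u + v)^T]linearD/= mulmxDl !mulmxDr uv vu addr0 add0r mxE.
by [].
Qed.

Lemma norm2_eq0 m (v : 'cV[R]_m) : norm2 v ^+ 2 <= 0 -> v = 0.
Proof.
rewrite sqr_sqrtr; last by apply: sumr_ge0 => i _; exact: sqr_ge0.
move=> v0; apply/matrixP => i j; rewrite ord1 mxE; apply/eqP; rewrite -sqrf_eq0.
rewrite eq_le sqr_ge0 andbT; apply: le_trans v0.
by rewrite (bigD1 i)//= lerDl; apply: sumr_ge0 => k _; exact: sqr_ge0.
Qed.

Variable C : 'M[R]_(M, p).

(** If [v] is in the left kernel of the Gram matrix, then [C *m v^T] has norm zero, and full column
    rank forces [v = 0]. *)
Lemma gram_unitmx : \rank C = p -> C^T *m C \in unitmx.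
Proof.
move=> rC; rewrite -row_free_unit -kermx_eq0.
apply/negP => /negP /rowV0Pn[v /sub_kermxP vC v0].
move/negP: v0; apply.
have : C *m v^T = 0.
  apply: norm2_eq0; rewrite norm2_sqr trmx_mul trmxK -mulmxA [_ *m (C *m _)]mulmxA.
  by rewrite mulmxA vC mul0mx mxE.
move=> /(congr1 trmx); rewrite trmx_mul trmxK trmx0 => vC0.
have rf : row_free C^T by rewrite /row_free mxrank_tr rC.
by apply/eqP/(row_free_inj rf); rewrite vC0 mul0mx.
Qed.

Hypothesis CC : C^T *m C \in unitmx.

(** By the normal equations the residual of the least-squares solution is orthogonal to the range of
    [C]. *)
Lemma least_squares_pythagoras (y : 'cV[R]_M) (b : 'cV[R]_p) :
  norm2 (C *m b - y) ^+ 2 = norm2 (C *m (b - least_squares C y)) ^+ 2 +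
    norm2 (C *m least_squares C y - y) ^+ 2.
Proof.
set bh := least_squares C y.
have CTv : C^T *m (C *m bh - y) = 0.
  by rewrite mulmxBr mulmxA /bh /least_squares !mulmxA mulmxV// mul1mx subrr.
rewrite -norm2_sqrD_orthogonal; last by rewrite trmx_mul -mulmxA CTv mulmx0.
by rewrite mulmxBr addrA subrK.
Qed.

(** In the Pythagorean identity only the first term depends on [b]; it vanishes only at the
    solution, as [C] is injective when its Gram matrix is invertible. *)
Lemma argmin_least_squares (y : 'cV[R]_M) :
  argmin (fun b : 'cV[R]_p => norm2 (C *m b - y) ^+ 2) = [set least_squares C y].
Proof.
apply/seteqP; split=> [b bmin|_ -> b] /=; last first.
  by rewrite (least_squares_pythagoras y b) lerDr sqr_ge0.
have := bmin (least_squares C y); rewrite (least_squares_pythagoras y b).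
rewrite gerDr => /norm2_eq0 => Cb.
apply/eqP; rewrite -subr_eq0; apply/eqP.
by rewrite -[LHS](mulKmx CC) -mulmxA Cb !mulmx0.
Qed.

End least_squares.

(** * The structured moment equations and the consistency of the estimator *)

Lemma stein_lhsE (R : realType) d p M (B : 'I_p -> 'M[R]_d) (U : 'I_M -> 'M[R]_d) b :
  stein_lhs B U b = design_mx B U *m b.
Proof.
apply/matrixP => m j; rewrite ord1 !mxE /linear_scale mulmx_suml raddf_sum/=.
by apply: eq_bigr => l _; rewrite mxE -scalemxAl mxtraceZ mulrC.
Qed.

Theorem proposition4p9 (R : realType) (d : nat) (alpha : R)
    (dO : measure_display) (Omega : measurableType dO) (P : probability Omega R)
    (W : nat -> {RV P >-> 'M[R]_d}) (Sigma : 'M[R]_d)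
    (p M : nat) (B : 'I_p -> 'M[R]_d) (beta : 'cV[R]_p)
    (U : 'I_M -> 'M[R]_d) :
  (0 < d)%N -> d%:R - 1 < alpha ->
  posdefmx Sigma ->
  mutually_independent W ->
  (forall (k : nat) (A : set 'M[R]_d), measurable A ->
     distribution P (W k) A = wishart alpha Sigma A) ->
  (forall j, (B j)^T = B j) ->
  Sigma = linear_scale B beta ->
  (forall m, (U m)^T = U m) ->
  \rank (design_mx B U) = p ->
  let C := design_mx B U in
  let y n omega := stein_rhs U alpha (fun k => W k omega) n in
  let betahat n omega := least_squares C (y n omega) in
  [/\ C^T *m C \in unitmx,
      forall n omega, (0 < n)%N ->
        argmin (fun b : 'cV[R]_p => norm2 (C *m b - y n omega) ^+ 2) =
        [set betahat n omega],
      {ae P, forall omega, (fun n => betahat n omega) @ \oo --> beta},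
      {ae P, forall omega,
        (fun n => linear_scale B (betahat n omega)) @ \oo --> Sigma} &
      forall n omega, (0 < n)%N ->
        argmin (fun b : 'cV[R]_p =>
          norm2 (stein_lhs B U b - y n omega) ^+ 2) (betahat n omega)].

Proof.
move=> d0 alpha_gt Sp indepW lawW _ SigmaE _ rankC C y betahat.
have CC : C^T *m C \in unitmx by exact: gram_unitmx.
have alpha0 : 0 < alpha by apply: le_lt_trans alpha_gt; rewrite subr_ge0 ler1n.
have ae_beta : {ae P, forall omega, forall j,
    betahat n omega j 0 @[n --> \oo] --> beta j 0}.
  apply: filterS (wishart_slln alpha0 Sp indepW lawW) => omega SLLN j.
  (* Each moment is a fixed linear combination of the entries of the sample mean, so the strong law
     applies entry by entry. *)
  have cvg_y m : y n omega m 0 @[n --> \oo] --> (C *m beta) m 0.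
    have -> : (C *m beta) m 0 =
        \sum_(ab : 'I_d * 'I_d) (alpha^-1 * U m ab.2 ab.1) * (alpha * Sigma ab.1 ab.2).
      rewrite -stein_lhsE mxE -SigmaE /mxtrace.
      under eq_bigr do rewrite mxE.
      rewrite pair_big/=; apply: eq_bigr => ab _.
      by rewrite mulrACA mulVf ?gt_eqF// mul1r mulrC.
    rewrite (_ : (fun n => _) = (fun n => \sum_(ab : 'I_d * 'I_d)
        (alpha^-1 * U m ab.2 ab.1) * (n%:R^-1 * \sum_(k < n) W k omega ab.1 ab.2))).
      by apply: cvg_sum_mull => ab; exact: SLLN.
    (* The identity holds at [n = 0] too, where the inverse of 0 is 0. *)
    apply/funext => n; rewrite mxE invfM.
    under [RHS]eq_bigr do rewrite mulrACA.
    rewrite -mulr_sumr; congr (_ * _).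
    under [RHS]eq_bigr do rewrite mulr_sumr.
    rewrite [RHS]exchange_big/=; apply: eq_bigr => k _.
    rewrite /mxtrace; under [LHS]eq_bigr do rewrite mxE.
    by rewrite pair_big/=; apply: eq_bigr => ab _; rewrite mulrC.
  (* The least-squares matrix is a left inverse of [C], so the limit [C *m beta] of the moments is
     sent to [beta]. *)
  have -> : beta = invmx (C^T *m C) *m C^T *m (C *m beta).
    by rewrite mulmxA -[_ *m C^T *m C]mulmxA mulVmx// mul1mx.
  rewrite (_ : (fun n => _) = (fun n => \sum_m (invmx (C^T *m C) *m C^T) j m *
      y n omega m 0)); last by apply/funext => n; rewrite mxE.
  by rewrite mxE; exact: cvg_sum_mull.
split=> //.
- by move=> n omega _; exact: argmin_least_squares.
- apply: filterS ae_beta => omega cvg_beta.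
  by apply: cvg_mx_entries => i j; rewrite ord1; exact: cvg_beta.
- apply: filterS ae_beta => omega cvg_beta.
  have lsE b a c : linear_scale B b a c = \sum_j B j a c * b j 0.
    by rewrite summxE; apply: eq_bigr => j _; rewrite mxE mulrC.
  apply: cvg_mx_entries => a c; rewrite SigmaE lsE.
  under eq_fun do rewrite lsE.
  exact: cvg_sum_mull.
- move=> n omega _.
  rewrite (_ : (fun b => _) = (fun b => norm2 (C *m b - y n omega) ^+ 2)).
    by rewrite argmin_least_squares.
  by apply/funext => b; rewrite stein_lhsE.
Qed.
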